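(* Let $L$ be a nonabelian finite simple group. Suppose that either $\mathrm{diam}(\Delta(L)) > 4$, or $\Delta(L)$ is balanced. Let $D$ be a finite dimensional division algebra over an arbitrary field, and let $D^{\#} = D\setminus\{0\}$ be its multiplicative group. Then $D^{\#}$ does not have any normal subgroup $N$ such that $D^{\#}/N \simeq L$.
   Context: For a finite group $X$, the commuting graph $\Delta(X)$ has vertex set $X\setminus\{1\}$, and its edges are the pairs $\{a,b\}$ with $a,b\in X\setminus\{1\}$, $a\neq b$, and $ab=ba$. Let $d$ be the graph distance on $\Delta(X)$ (with $d(x,y)=\infty$ if $x,y$ lie in different connected components) and let $\mathrm{diam}(\Delta(X))$ be the supremum of the distances between vertices. The graph $\Delta(X)$ is called balanced if there exist vertices $x,y$ of $\Delta(X)$ such that the distances $d(x,y)$, $d(x,xy)$, $d(y,xy)$, $d(x,x^{-1}y)$, $d(y,x^{-1}y)$ are all bigger than $3$ (note that $d(x,y)>3$ forces $xy\ne 1$ and $x^{-1}y\neq 1$). *)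

(* Defs.v *)
From HB Require Import structures.
From mathcomp Require Import all_boot all_order all_algebra.
From mathcomp Require Import all_fingroup all_solvable all_field.
From mathcomp Require Import generic_quotient.
From mathcomp Require Import boolp constructive_ereal.

Set Implicit Arguments.
Unset Strict Implicit.
Unset Printing Implicit Defensive.

Import Order.TTheory GRing.Theory.

Section Distance.
Variables (T : finType) (e : rel T).

Definition walk (n : nat) (x y : T) : bool :=
  [exists p : n.-tuple T, path e x p && (last x p == y)].

Lemma connect_walk (x y : T) : connect e x y -> exists n, walk n x y.
Proof.
case/connectP=> p ep ->; exists (size p).
by apply/existsP; exists (in_tuple p); rewrite ep eqxx.
Qed.

(* The extended type \bar int provides the value +oo and the order; all
   distances are nonnegative. *)
Definition dist (x y : T) : \bar int :=
  match @idP (connect e x y) with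
  | ReflectT exy => EFin (Posz (ex_minn (connect_walk exy)))
  | ReflectF _ => +oo%E
  end.

(* The vertex set is passed separately so that the ambient type may be larger
   than the graph; a supremum over a finite set of values >= 0 is a maximum. *)
Definition diam (V : {set T}) : \bar int :=
  \big[Order.max/0%E]_(x in V) \big[Order.max/0%E]_(y in V) dist x y.

End Distance.

Local Open Scope group_scope.

Section CommutingGraph.
Variable L : finGroupType.

Definition commuting_edge (x y : L) : bool :=
  [&& x != 1, y != 1, x != y & x * y == y * x].

Definition commuting_dist : L -> L -> \bar int := dist commuting_edge.

Definition commuting_diam : \bar int := diam commuting_edge [set: L]^#.

(* 1 is isolated for commuting_edge, hence at infinite distance from every
   vertex. This junk value is harmless below: if x * y = 1 or x^-1 * y = 1 then
   x and y commute, which the first inequality excludes. *)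
Definition balanced : Prop :=
  exists x y : L, [/\ x != 1, y != 1 &
    [/\ (3%:E < commuting_dist x y)%E,
        (3%:E < commuting_dist x (x * y))%E,
        (3%:E < commuting_dist y (x * y))%E,
        (3%:E < commuting_dist x (x^-1 * y))%E &
        (3%:E < commuting_dist y (x^-1 * y))%E]].

End CommutingGraph.

Section Units.
Variable R : unitRingType.

(* The group of units of a possibly infinite ring; in a division ring it
   consists of all the nonzero elements. *)
Inductive units := Units (u : R) of u \is a GRing.unit.

Definition units_val (x : units) : R := let: Units u _ := x in u.

HB.instance Definition _ := [isSub for units_val].
HB.instance Definition _ := [Choice of units by <:].

Fact units_inv_subproof (x : units) : ((val x)^-1)%R \is a GRing.unit.
Proof. by rewrite unitrV (valP x). Qed.

Fact units_mul_subproof (x y : units) : (val x * val y)%R \is a GRing.unit.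
Proof. by rewrite (unitrMr _ (valP x)) (valP y). Qed.

Definition units_one : units := Units (@unitr1 R).
Definition units_inv (x : units) : units := Units (units_inv_subproof x).
Definition units_mul (x y : units) : units := Units (units_mul_subproof x y).

Fact units_mulA : associative units_mul.
Proof. by move=> x y z; apply/val_inj/mulrA. Qed.
Fact units_mul1g : left_id units_one units_mul.
Proof. by move=> x; apply/val_inj/mul1r. Qed.
Fact units_mulg1 : right_id units_one units_mul.
Proof. by move=> x; apply/val_inj/mulr1. Qed.
Fact units_mulVg : left_inverse units_one units_inv units_mul.
Proof. by move=> x; apply/val_inj/(mulVr (valP x)). Qed.
Fact units_mulgV : right_inverse units_one units_inv units_mul.
Proof. by move=> x; apply/val_inj/(mulrV (valP x)). Qed.

HB.instance Definition _ := isGroup.Build units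
  units_mulA units_mul1g units_mulg1 units_mulVg units_mulgV.

End Units.

Record normal_subgroup (G : groupType) := NormalSubgroup {
  ns_set :> G -> Prop;
  ns_1 : ns_set 1;
  ns_M : forall x y, ns_set x -> ns_set y -> ns_set (x * y);
  ns_V : forall x, ns_set x -> ns_set x^-1;
  ns_J : forall x y, ns_set x -> ns_set (x ^ y)
}.

Section Quotient.
Variables (G : groupType) (N : normal_subgroup G).

Definition coset_rel : rel G := fun x y => `[< N (x^-1 * y) >].

Fact coset_rel_refl : reflexive coset_rel.
Proof. by move=> x; apply/asboolP; rewrite mulVg; apply: ns_1. Qed.

Fact coset_rel_sym : symmetric coset_rel.
Proof.
suff S x y : coset_rel x y -> coset_rel y x by move=> x y; apply/idP/idP; apply: S.
by move=> /asboolP/ns_V; rewrite invgM invgK => ?; apply/asboolP.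
Qed.

Fact coset_rel_trans : transitive coset_rel.
Proof.
move=> y x z /asboolP Nxy /asboolP Nyz; apply/asboolP.
by have := ns_M Nxy Nyz; rewrite -mulgA mulKVg.
Qed.

Canonical coset_equiv :=
  EquivRel coset_rel coset_rel_refl coset_rel_sym coset_rel_trans.

Local Open Scope quotient_scope.

(* The quotient of a possibly infinite group; coset_of is only for finite
   ones. *)
Definition group_quotient := {eq_quot coset_equiv}.

HB.instance Definition _ := EqQuotient.on group_quotient.
HB.instance Definition _ := Choice.on group_quotient.

Definition qone : group_quotient := \pi_group_quotient 1.
Definition qmul (a b : group_quotient) : group_quotient :=
  \pi_group_quotient (repr a * repr b).
Definition qinv (a : group_quotient) : group_quotient :=
  \pi_group_quotient (repr a)^-1.

Lemma eq_piP (x y : G) :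
  \pi_group_quotient x = \pi_group_quotient y <-> N (x^-1 * y).
Proof. by split=> [/eqmodP/asboolP|Nxy] //; apply/eqmodP/asboolP. Qed.

Lemma repr_pi (x : G) : N (x^-1 * repr (\pi_group_quotient x)).
Proof. by apply/eq_piP; rewrite reprK. Qed.

Lemma qmul_pi (x y : G) :
  qmul (\pi_group_quotient x) (\pi_group_quotient y) =
  \pi_group_quotient (x * y).
Proof.
apply/esym/eq_piP; set x' := repr _; set y' := repr _.
have -> : (x * y)^-1 * (x' * y') = (x^-1 * x') ^ y * (y^-1 * y').
  by rewrite conjgE invgM !mulgA mulgK.
by apply: ns_M; [apply: ns_J|]; apply: repr_pi.
Qed.

Lemma qinv_pi (x : G) :
  qinv (\pi_group_quotient x) = \pi_group_quotient x^-1.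
Proof.
apply/eq_piP; rewrite invgK; set x' := repr _.
have -> : x' * x^-1 = (x^-1 * x') ^ x^-1.
  by rewrite conjgE invgK !mulgA mulgV mul1g.
by apply: ns_J; apply: repr_pi.
Qed.

Fact qmulA : associative qmul.
Proof.
elim/quotW=> x; elim/quotW=> y; elim/quotW=> z.
by rewrite (qmul_pi y z) (qmul_pi x y) (qmul_pi x) (qmul_pi _ z) mulgA.
Qed.
Fact qmul1g : left_id qone qmul.
Proof. by elim/quotW=> x; rewrite qmul_pi mul1g. Qed.
Fact qmulg1 : right_id qone qmul.
Proof. by elim/quotW=> x; rewrite qmul_pi mulg1. Qed.
Fact qmulVg : left_inverse qone qinv qmul.
Proof. by elim/quotW=> x; rewrite qinv_pi qmul_pi mulVg. Qed.
Fact qmulgV : right_inverse qone qinv qmul.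
Proof. by elim/quotW=> x; rewrite qinv_pi qmul_pi mulgV. Qed.

HB.instance Definition _ := isGroup.Build group_quotient
  qmulA qmul1g qmulg1 qmulVg qmulgV.

End Quotient.

Definition group_isomorphic (G H : groupType) : Prop :=
  exists f : G -> H, {morph f : x y / x * y} /\ bijective f.

(* Main.v *)
Require Import Defs.
From HB Require Import structures.
From mathcomp Require Import all_boot all_order all_algebra.
From mathcomp Require Import all_fingroup all_solvable all_field.
From mathcomp Require Import constructive_ereal.
From mathcomp Require Import boolp.
From mathcomp Require classical_sets.

Set Implicit Arguments.
Unset Strict Implicit.
Unset Printing Implicit Defensive.

Import Order.TTheory GRing.Theory.

(** Suppose that psi maps the multiplicative group of D onto a nonabelian finite
    simple group L, and let N be its kernel.  The proof shows that N is open for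
    a valuation of D, that the same can then be said of the residue division
    ring, and so on for ever, whereas a minimal valuation ring of the relevant
    kind exists by Zorn's lemma.

    Addition is tied to the commuting graph by the remark that 1 + w commutes
    with w: if one of x, y and x + y lies in N, the images of the other two
    commute ([psi_add_commute], [psi_sum1_commute]).  For a in D write N(a) for
    the set of the n in N such that a + n is in N.  If N(a) and N(b) were
    incomparable for inclusion, sums such as a + n, b + n and a + b + n would draw
    a short path between the images of a and b; so N(a) and N(b) are comparable
    when these images are far apart in the graph ([far4_comparable] when
    the diameter is large, [far3_comparable] when the graph is balanced).  It
    follows that the sets N(b), for b in a suitable coset of N, form a chain, and
    this chain is a total preorder on N that is invariant under translations
    ([add_le_total]).  It behaves like the order of a valuation up to a bounded
    error om: if n exceeds om then 1 + n is in N and is equivalent to 1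
    ([exists_leveled_order]).

    As D is algebraic over its center, every element of N has a power that is,
    up to om, central ([central_tie]); hence there is a central z beyond all the
    errors met in the argument ([central_above]).  Ignoring the elements of N
    that are infinitesimal with respect to z turns N into an ordered group on
    which the whole group of D acts trivially ([conj_eqv]).  The transfer extends
    this order to D, and the elements that it makes nonnegative form an invariant
    valuation ring ([finerD] is the point).  If m is its maximal ideal, then the
    image of 1 + m in L is trivial: as L is perfect, a full image would also be
    the image of 1 + I for ideals I as small as desired ([congruence_image1]).

    All this is done relatively to an invariant valuation ring O such that 1 plus
    its maximal ideal is contained in N, that is, in the residue division ring of
    O; the result is a strictly smaller ring of the same kind ([exists_finer]).
    The sets N(a) are not empty, because a finite residue ring would be
    commutative by Wedderburn's theorem and because, in an infinite one, a
    colouring argument shows that every element is a difference of two elements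
    of N ([unit_difference]). *)

(** * Minima and preordered groups *)

Local Open Scope group_scope.

Lemma seq_minimum (I : eqType) (le : I -> I -> Prop) (s : seq I) :
  (forall i j, i \in s -> j \in s -> le i j \/ le j i) ->
  (forall j i k, i \in s -> j \in s -> k \in s -> le i j -> le j k -> le i k) ->
  s != [::] -> exists2 i, i \in s & forall j, j \in s -> le i j.
Proof.
elim: s => [|x s IH] // tot tr _.
have xx : le x x by case: (tot x x); rewrite ?mem_head.
have [->|s0] := eqVneq s [::].
  by exists x; rewrite ?mem_head // => j; rewrite inE => /eqP ->.
have sub j : j \in s -> j \in x :: s by rewrite inE orbC => ->.
have [| |i si min_i] := IH _ _ s0.
- by move=> i j si sj; apply: tot; apply: sub.
- by move=> j i k si sj sk; apply: tr; apply: sub.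
have [xi|ix] := tot x i (mem_head _ _) (sub i si).
  exists x; rewrite ?mem_head // => j; rewrite inE => /orP[/eqP -> //|sj].
  by apply: (tr i) (min_i j sj); rewrite ?mem_head ?sub.
exists i; first exact: sub.
by move=> j; rewrite inE => /orP[/eqP ->|/min_i].
Qed.

(** The order of a valuation, seen on a group of which it is a total preorder:
    elements of the same value are equivalent but need not be equal. *)
Record group_order (T : groupType) (le : T -> T -> Prop) : Prop := GroupOrder {
  go_trans : forall b a c, le a b -> le b c -> le a c;
  go_total : forall a b, le a b \/ le b a;
  go_mul2l : forall c a b, le a b -> le (c * a) (c * b);
  go_mul2r : forall c a b, le a b -> le (a * c) (b * c)
}.

Section OrderedGroup.
Variables (T : groupType) (le : T -> T -> Prop).
Hypothesis leG : group_order le.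
Implicit Types a b m n w : T.

Let letr := go_trans leG.

Lemma go_refl a : le a a.
Proof. by case: (go_total leG a a). Qed.

Lemma go_mul a b c d : le a b -> le c d -> le (a * c) (b * d).
Proof.
by move=> ab cd; apply: letr (go_mul2r leG c ab) (go_mul2l leG b cd).
Qed.

Lemma go_lI c a b : le (c * a) (c * b) -> le a b.
Proof. by move/(go_mul2l leG c^-1); rewrite !mulKg. Qed.

Lemma go_rI c a b : le (a * c) (b * c) -> le a b.
Proof. by move/(go_mul2r leG c^-1); rewrite !mulgK. Qed.

Lemma go_inv a b : le a b -> le b^-1 a^-1.
Proof.
by move=> ab; apply: (@go_lI b); apply: (@go_rI a); rewrite mulgV mul1g mulgVK.
Qed.

Lemma go_exp k a b : le a b -> le (a ^+ k) (b ^+ k).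
Proof.
move=> ab; elim: k => [|k IH]; first exact: go_refl.
by rewrite !expgS; apply: go_mul.
Qed.

Lemma go_exp_ge1 k a : le 1 a -> le 1 (a ^+ k).
Proof. by move/(go_exp k); rewrite expg1n. Qed.

Lemma go_exp_mono j k a : le 1 a -> (j <= k)%N -> le (a ^+ j) (a ^+ k).
Proof.
move=> a1 /subnKC <-; rewrite expgnDr -{1}[a ^+ j]mulg1.
exact/(go_mul2l leG)/go_exp_ge1.
Qed.

Lemma go_sq1 a : a * a = 1 -> le a 1 /\ le 1 a.
Proof.
move=> aa; case: (go_total leG 1 a) => a1; split=> //;
  by have := go_mul2l leG a a1; rewrite aa mulg1.
Qed.

Lemma go_upper_bound (s : seq T) : exists b, forall a, a \in s -> le a b.
Proof.
elim: s => [|x s [b sb]]; first by exists 1.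
case: (go_total leG x b) => xb; [exists b | exists x] => a; rewrite inE.
  by case/orP=> [/eqP ->|/sb].
case/orP=> [/eqP ->|/sb ab]; first exact: go_refl.
exact: letr ab xb.
Qed.

Lemma go_expM_comm a b k :
  le (a * b) (b * a) -> le (a ^+ k * b ^+ k) ((a * b) ^+ k).
Proof.
move=> ab; elim: k => [|k IH]; first by rewrite !expg0 mulg1; apply: go_refl.
rewrite !expgSr; apply: (letr (b := a ^+ k * b ^+ k * (a * b))); last first.
  exact: go_mul2r.
rewrite -!mulgA; apply: (go_mul2l leG); rewrite !mulgA; apply: (go_mul2r leG).
elim: k {IH} => [|k IH]; first by rewrite !expg0 mulg1 mul1g; apply: go_refl.
rewrite !expgS mulgA; apply: (letr (go_mul2r leG _ ab)).
by rewrite -!mulgA; apply: (go_mul2l leG).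
Qed.

(** In the absence of commutativity a power of a product still dominates one of
    the two products of powers: if a * b <= b * a, moving the factors b to the
    right only decreases (a * b) ^+ k. *)
Lemma go_expM a b k :
  le (a ^+ k * b ^+ k) ((a * b) ^+ k) \/ le (b ^+ k * a ^+ k) ((a * b) ^+ k).
Proof.
case: (go_total leG (a * b) (b * a)) => ab; [left|right].
  exact: go_expM_comm.
exact: letr (go_expM_comm k ab) (go_exp k ab).
Qed.

Variable z : T.
Hypotheses (zC : forall a, commute z a) (z1 : le 1 z) (z1' : ~ le z 1).

(** Modulo the elements that are infinitesimal with respect to z, pos a means
    1 <= a. *)
Definition pos a := exists c, forall k, le (z ^- c) (a ^+ k).
Definition infinitesimal a := pos a /\ pos a^-1.

Lemma posM a b : pos a -> pos b -> pos (a * b).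
Proof.
move=> [c ac] [d bd]; exists (c + d)%N => k.
rewrite expgnDr invgM; case: (go_expM a b k); apply: letr.
  have -> : z ^- d * z ^- c = z ^- c * z ^- d.
    by rewrite -!invgM -!expgnDr addnC.
  exact: go_mul.
exact: go_mul.
Qed.

Lemma pos_ge1 a : le 1 a -> pos a.
Proof. by move=> a1; exists 0%N => k; rewrite expg0 invg1; apply: go_exp_ge1. Qed.

Lemma pos_or a : pos a \/ pos a^-1.
Proof.
case: (go_total leG 1 a) => a1; [left | right]; apply: pos_ge1 => //.
by rewrite -invg1; apply: go_inv.
Qed.

Lemma posX k a : pos a -> pos (a ^+ k).
Proof.
move=> pa; elim: k => [|k IH]; first exact/pos_ge1/go_refl.
by rewrite expgS; apply: posM.
Qed.

Lemma pos_root k a : (0 < k)%N -> pos (a ^+ k) -> pos a.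
Proof.
move=> k0 [c ac]; case: (go_total leG 1 a) => a1; first exact: pos_ge1.
exists c => j; apply: letr (ac j) _; rewrite -expgnA.
have a'1 : le 1 a^-1 by rewrite -invg1; apply: go_inv.
have jk : (j <= k * j)%N by rewrite leq_pmull.
by have := go_inv (go_exp_mono a'1 jk); rewrite !expVgn !invgK.
Qed.

Lemma pos_conj a b : pos a -> pos (a ^ b).
Proof.
move=> [c ac]; exists c => k; rewrite -conjXg conjgE.
have -> : z ^- c = b^-1 * (z ^- c * b).
  have zb : commute (z ^- c) b.
    by apply/commute_sym/commuteV/commuteX/commute_sym.
  by rewrite zb mulKg.
by apply: (go_mul2l leG); apply: (go_mul2r leG).
Qed.

Lemma not_pos_inv a : ~ pos a^-1 -> le 1 a.
Proof.
move=> na; case: (go_total leG 1 a) => // a1; case: na; apply: pos_ge1.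
by rewrite -invg1; apply: go_inv.
Qed.

(** An element that is not infinitesimal is archimedean with respect to z: its
    powers eventually exceed any given power of z. *)
Lemma not_pos_inv_large a c :
  ~ pos a^-1 -> exists k, forall j, (k <= j)%N -> le (z ^+ c) (a ^+ j).
Proof.
move=> na; have [k ak] : exists k, ~ le (z ^- c) (a^-1 ^+ k).
  by apply: contrapT => nk; apply: na; exists c => k; apply: contrapT => ak;
     apply: nk; exists k.
exists k => j kj; apply: letr (go_exp_mono (not_pos_inv na) kj).
case: (go_total leG (z ^- c) (a^-1 ^+ k)) => // /go_inv.
by rewrite expVgn !invgK.
Qed.

Lemma infM a b : infinitesimal a -> infinitesimal b -> infinitesimal (a * b).
Proof. by move=> [? ?] [? ?]; split; rewrite ?invgM; apply: posM. Qed.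

Lemma infV a : infinitesimal a -> infinitesimal a^-1.
Proof. by move=> [? ?]; split; rewrite ?invgK. Qed.

Lemma inf1 : infinitesimal 1.
Proof. by split; rewrite ?invg1; apply/pos_ge1/go_refl. Qed.

Lemma inf_conj a b : infinitesimal a -> infinitesimal (a ^ b).
Proof. by move=> [? ?]; split; rewrite -?conjVg; apply: pos_conj. Qed.

(** Arbitrarily large powers of m and n are within z ^+ c of the same central
    element. *)
Definition close_powers c m n k :=
  exists K w, [/\ (k <= K)%N, forall a, commute w a,
    le (w * z ^- c) (n ^+ K) /\ le (n ^+ K) (w * z ^+ c)
  & le (w * z ^- c) (m ^+ K) /\ le (m ^+ K) (w * z ^+ c)].

Lemma close_sym c m n k : close_powers c m n k -> close_powers c n m k.
Proof. by case=> K [w [? ? ? ?]]; exists K, w. Qed.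

(** Write m = a * n.  By [go_expM], m ^+ K exceeds a ^+ K * n ^+ K up to the order
    of the factors, so that a ^+ K is at most z ^+ (2 * c), for unboundedly many
    exponents K. *)
Lemma close_pos c m n : (forall k, close_powers c m n k) -> pos (n * m^-1).
Proof.
move=> mn; exists (c + c)%N => k.
set a := m * n^-1; have -> : n * m^-1 = a^-1 by rewrite invgM invgK.
rewrite expVgn; apply: go_inv.
case: (go_total leG 1 a) => a1; last first.
  apply: letr (go_exp k a1) _; rewrite expg1n; exact: go_exp_ge1.
have [K [w [kK wC [wn _] [_ mw]]]] := mn k.
apply: letr (go_exp_mono a1 kK) _.
have am : m = a * n by rewrite mulgVK.
have wz (i : nat) : commute w (z ^+ i) by exact: wC.
have H : le (w * (a ^+ K * z ^- c)) (m ^+ K).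
  rewrite am; case: (go_expM a n K); apply: letr.
    by rewrite mulgA wC -mulgA; apply: (go_mul2l leG).
  have zaK : commute (z ^- c) (a ^+ K).
    by apply/commute_sym/commuteV/commuteX/commute_sym.
  by rewrite -zaK mulgA; apply: (go_mul2r leG).
have := letr H mw => /go_lI /(go_mul2r leG (z ^+ c)).
by rewrite mulgVK expgnDr.
Qed.

Lemma close_inf c m n : (forall k, close_powers c m n k) -> infinitesimal (m * n^-1).
Proof.
move=> mn; split; first by apply: (@close_pos c) => k; apply/close_sym.
by rewrite invgM invgK; apply: (@close_pos c).
Qed.

End OrderedGroup.

(** * Distances in the commuting graph *)

Section Walks.
Variables (T : finType) (e : rel T).

Lemma dist_le n x y : walk e n x y -> (dist e x y <= n%:Z%:E)%E.
Proof.
move=> xy; rewrite /dist; case: {-}_ / idP => [exy|nxy].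
  by case: ex_minnP => m _ min_m; rewrite lee_fin lez_nat; apply: min_m.
by case: nxy; case/existsP: xy => p /andP[ep /eqP <-]; apply/connectP; exists p.
Qed.

Lemma walkS n x y z : walk e n x y -> e y z -> walk e n.+1 x z.
Proof.
case/existsP=> p /andP[ep /eqP py] yz; apply/existsP.
by exists [tuple of rcons p z]; rewrite rcons_path last_rcons ep py yz /=.
Qed.

End Walks.

Section CommutingGraph.
Variable L : finGroupType.
Implicit Types x y s t u : L.

(** For x and y different from 1, these are the conditions d(x, y) > 2, 3 and 4 in
    the commuting graph, allowing steps that do not move. *)
Definition far2 x y := forall s, commute x s -> commute s y -> s = 1.
Definition far3 x y :=
  forall s t, commute x s -> commute s t -> commute t y -> s = 1 \/ t = 1.
Definition far4 x y := forall s t u,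
  commute x s -> commute s t -> commute t u -> commute u y ->
  [\/ s = 1, t = 1 | u = 1].

Lemma far3_far2 x y : far3 x y -> far2 x y.
Proof. by move=> xy s xs sy; case: (xy s s). Qed.

Lemma far4_far3 x y : far4 x y -> far3 x y.
Proof. by move=> xy s t xs st ty; case: (xy s t t) => //; tauto. Qed.

Lemma far3_sym x y : far3 x y -> far3 y x.
Proof.
move=> xy s t ys st tx; case: (xy t s); try exact: commute_sym; tauto.
Qed.

Lemma commuteVl x y : commute x^-1 y -> commute x y.
Proof. by move=> xy; rewrite -[x]invgK; apply/commute_sym/commuteV/commute_sym. Qed.

Lemma far3V x y : far3 x y -> far3 x^-1 y.
Proof. by move=> xy s t /commuteVl; apply: xy. Qed.

Lemma far2V x y : far2 x y -> far2 x y^-1.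
Proof. by move=> xy s xs /commute_sym/commuteVl/commute_sym; apply: xy. Qed.

Lemma far4V x y : far4 x y -> far4 x^-1 y.
Proof. by move=> xy s t u /commuteVl; apply: xy. Qed.

Lemma far4_sym x y : far4 x y -> far4 y x.
Proof.
move=> xy s t u ys st tu ux; case: (xy u t s); try exact: commute_sym.
- by move->; apply: Or33.
- by move->; apply: Or32.
- by move->; apply: Or31.
Qed.

Definition walk_le n x y :=
  exists2 m, (m <= n)%N & walk (@commuting_edge L) m x y.

Lemma walk_le0 x : walk_le 0 x x.
Proof. by exists 0%N => //; apply/existsP; exists [tuple]; rewrite /= eqxx. Qed.

Lemma walk_leS n x y z :
  walk_le n x y -> y != 1 -> z != 1 -> commute y z -> walk_le n.+1 x z.
Proof.
move=> [m mn xy] y1 z1 yz; have [<-|yDz] := eqVneq y z; first by exists m => //; exact: leqW.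
exists m.+1 => //; apply: walkS xy _; rewrite /commuting_edge y1 z1 yDz /=.
exact/eqP.
Qed.

Lemma walk_le_dist n x y :
  (n%:Z%:E < commuting_dist x y)%E -> ~ walk_le n x y.
Proof.
move=> nxy [m mn /dist_le xy]; have := lt_le_trans nxy xy.
by rewrite lte_fin ltz_nat ltnNge mn.
Qed.

Lemma dist3_far3 x y : x != 1 -> y != 1 ->
  (3%:Z%:E < commuting_dist x y)%E -> far3 x y.
Proof.
move=> x1 y1 /walk_le_dist xy s t xs st ty.
have [->|s1] := eqVneq s 1; first by left.
have [->|t1] := eqVneq t 1; first by right.
case: xy; apply: walk_leS ty => //; apply: walk_leS st => //.
by apply: walk_leS xs => //; apply: walk_le0.
Qed.

Lemma dist4_far4 x y : x != 1 -> y != 1 ->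
  (4%:Z%:E < commuting_dist x y)%E -> far4 x y.
Proof.
move=> x1 y1 /walk_le_dist xy s t u xs st tu uy.
have [->|s1] := eqVneq s 1; first by apply: Or31.
have [->|t1] := eqVneq t 1; first by apply: Or32.
have [->|u1] := eqVneq u 1; first by apply: Or33.
case: xy; apply: walk_leS uy => //; apply: walk_leS tu => //.
by apply: walk_leS st => //; apply: walk_leS xs => //; apply: walk_le0.
Qed.

Lemma diam4_far4 : (4%:E < commuting_diam L)%E ->
  exists x y : L, [/\ x != 1, y != 1 & far4 x y].
Proof.
move=> dL; apply: contrapT => no_far4; move: dL; apply/negP; rewrite -leNgt.
rewrite /commuting_diam /diam.
have max_le (P : {set L}) (F : L -> \bar int) :
    (forall x, x \in P -> (F x <= 4%:E)%E) ->
    (\big[Order.max/0%E]_(x in P) F x <= 4%:E)%E.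
  by move=> FP; elim/big_ind: _ => // a b a4 b4; rewrite ge_max a4 b4.
apply: (max_le) => x; rewrite !inE andbT => x1.
apply: max_le => y; rewrite !inE andbT => y1.
rewrite leNgt; apply/negP => xy; apply: no_far4; exists x, y.
by split=> //; apply: dist4_far4.
Qed.

(** What the two hypotheses on the graph have in common for the sequel: the first
    alternative is a distance larger than 4, the second collects the distances
    that are used when the graph is balanced. *)
Definition compatible_pair x y :=
  far4 x y \/ [/\ far3 x y, far2 y (x * y), far2 y (x^-1 * y) & far2 x (y^-1 * x)].

Lemma graph_pair : (4%:E < commuting_diam L)%E \/ balanced L ->
  exists x y, [/\ x != 1, y != 1 & compatible_pair x y].
Proof.
case=> [/diam4_far4[x [y [x1 y1 xy]]]|].
  by exists x, y; split=> //; left.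
case=> x [y [x1 y1 [xy x_xy y_xy x_xVy y_xVy]]]; exists x, y; split=> //; right.
have far3_xy := dist3_far3 x1 y1 xy.
have ncxy : ~ commute x y.
  by move=> cxy; case/eqP: x1; case: (far3_xy x x).
have xDy : x != y by apply/eqP => exy; apply: ncxy; rewrite exy.
have xy1 : x * y != 1.
  by rewrite mulg_eq1; apply/eqP => exy; apply: ncxy; rewrite exy;
     apply/commute_sym/commuteV.
have xVy1 : x^-1 * y != 1.
  by rewrite mulg_eq1 (inj_eq (@invg_inj _)).
split=> //.
- exact/far3_far2/dist3_far3.
- exact/far3_far2/dist3_far3.
- have -> : y^-1 * x = (x^-1 * y)^-1 by rewrite invgM invgK.
  exact/far2V/far3_far2/dist3_far3.
Qed.

End CommutingGraph.

Local Close Scope group_scope.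
Local Open Scope ring_scope.

(** * Division rings and their invariant valuation rings *)

Definition division_ring (D : unitRingType) :=
  forall x : D, x != 0 -> x \is a GRing.unit.

Section DivisionRing.
Variable D : unitRingType.
Hypothesis divD : division_ring D.
Implicit Types x y : D.

Lemma div_mul_eq0 x y : (x * y == 0) = (x == 0) || (y == 0).
Proof.
have [->|/divD Ux] := eqVneq x 0; first by rewrite mul0r eqxx.
by rewrite -[in LHS](mulr0 x) (inj_eq (mulrI Ux)).
Qed.

Lemma div_inv_eq0 x : (x^-1 == 0) = (x == 0).
Proof.
have [->|/divD Ux] := eqVneq x 0; first by rewrite invr0 eqxx.
by apply/negbTE; move: Ux; rewrite -unitrV; apply: contraTneq => ->; rewrite unitr0.
Qed.

Lemma div_exp_eq0 x k : x != 0 -> (x ^+ k == 0) = false.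
Proof.
move=> x0; apply/negbTE; elim: k => [|k IH]; first by rewrite oner_neq0.
by rewrite exprS div_mul_eq0 negb_or x0.
Qed.

Definition divE := (div_mul_eq0, div_inv_eq0, oppr_eq0, negb_or, oner_neq0).

Lemma div_mulVr x : x != 0 -> x^-1 * x = 1. Proof. by move/divD/mulVr. Qed.
Lemma div_mulrV x : x != 0 -> x * x^-1 = 1. Proof. by move/divD/mulrV. Qed.
Lemma div_mulKr x y : x != 0 -> x^-1 * (x * y) = y.
Proof. by move=> x0; rewrite mulrA div_mulVr ?mul1r. Qed.
Lemma div_mulVKr x y : x != 0 -> x * (x^-1 * y) = y.
Proof. by move=> x0; rewrite mulrA div_mulrV ?mul1r. Qed.
Lemma div_mulrK x y : x != 0 -> y * x * x^-1 = y.
Proof. by move=> x0; rewrite -mulrA div_mulrV ?mulr1. Qed.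
Lemma div_mulrVK x y : x != 0 -> y * x^-1 * x = y.
Proof. by move=> x0; rewrite -mulrA div_mulVr ?mulr1. Qed.
Lemma div_invM x y : x != 0 -> y != 0 -> (x * y)^-1 = y^-1 * x^-1.
Proof. by move=> /divD x0 /divD y0; rewrite invrM. Qed.

End DivisionRing.

(** These are the invariant valuation rings of a division ring; invariance under
    inner automorphisms is the last axiom. *)
Structure valuation_ring (D : unitRingType) := ValuationRing {
  vr_mem :> D -> Prop;
  vr_div : division_ring D;
  vr1 : vr_mem 1;
  vrB : forall x y, vr_mem x -> vr_mem y -> vr_mem (x - y);
  vrM : forall x y, vr_mem x -> vr_mem y -> vr_mem (x * y);
  vrV : forall x, x != 0 -> vr_mem x \/ vr_mem x^-1;
  vrJ : forall x r, x != 0 -> vr_mem r -> vr_mem (x^-1 * r * x)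
}.

Section Valuation.
Variables (D : unitRingType) (O : valuation_ring D).
Implicit Types x y r s : D.

Let divD := vr_div O.
Let divE := divE divD.
Let OM := @vrM _ O.
Let OB := @vrB _ O.
Let O1 := vr1 O.

Definition vunit x := [/\ x != 0, O x & O x^-1].
(** As 0^-1 = 0, the zero element has to be added by hand. *)
Definition vmax x := x = 0 \/ ~ O x^-1.

Lemma vr0 : O 0. Proof. by rewrite -(subrr 1); apply: OB. Qed.
Lemma vrN x : O x -> O (- x).
Proof. by move=> Ox; rewrite -sub0r; apply: OB => //; apply: vr0. Qed.
Lemma vrD x y : O x -> O y -> O (x + y).
Proof. by move=> Ox Oy; rewrite -[y]opprK; apply/OB/vrN. Qed.
Lemma vrX x k : O x -> O (x ^+ k).
Proof. by move=> Ox; elim: k => [|k IH]; rewrite ?expr0 // exprS; apply: OM. Qed.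

Lemma vmax_O x : vmax x -> O x.
Proof.
case=> [->|nx]; first exact: vr0.
have [->|x0] := eqVneq x 0; first exact: vr0.
by case: (@vrV _ O _ x0).
Qed.

Lemma vunit_neq0 x : vunit x -> x != 0. Proof. by case. Qed.
Lemma vunit_O x : vunit x -> O x. Proof. by case. Qed.

Lemma vunitP x : O x -> ~ vmax x -> vunit x.
Proof.
move=> Ox mx; have x0 : x != 0 by apply/eqP => x0; apply: mx; left.
by split=> //; apply: contrapT => nx; apply: mx; right.
Qed.

Lemma vunit_nmax x : vunit x -> ~ vmax x.
Proof. by case=> x0 Ox Ox' [/eqP|//]; apply/negP. Qed.

Lemma vmaxMl x y : O x -> vmax y -> vmax (x * y).
Proof.
move=> Ox [->|ny]; first by rewrite mulr0; left.
have [->|x0] := eqVneq x 0; first by rewrite mul0r; left.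
have [->|y0] := eqVneq y 0; first by rewrite mulr0; left.
right=> Oxy; apply: ny; rewrite -(div_mulrVK divD y^-1 x0).
by apply: OM => //; rewrite -div_invM.
Qed.

Lemma vmaxMr x y : vmax x -> O y -> vmax (x * y).
Proof.
case=> [->|nx] Oy; first by rewrite mul0r; left.
have [->|x0] := eqVneq x 0; first by rewrite mul0r; left.
have [->|y0] := eqVneq y 0; first by rewrite mulr0; left.
right=> Oxy; apply: nx; rewrite -(div_mulVKr divD x^-1 y0).
by apply: OM => //; rewrite -div_invM.
Qed.

Lemma vmax0 : vmax 0. Proof. by left. Qed.
Lemma vmaxN x : vmax x -> vmax (- x).
Proof. by move=> mx; rewrite -mulN1r; apply: vmaxMl => //; apply: vrN. Qed.

(** Of two nonzero elements one divides the other in the valuation ring. *)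
Lemma vmaxD x y : vmax x -> vmax y -> vmax (x + y).
Proof.
have [->|x0] := eqVneq x 0; first by rewrite add0r.
have [->|y0] := eqVneq y 0; first by rewrite addr0.
move=> mx my; have w0 : x^-1 * y != 0 by rewrite !divE x0.
case: (@vrV _ O _ w0) => Ow.
  have -> : x + y = x * (1 + x^-1 * y) by rewrite mulrDr mulr1 div_mulVKr.
  by apply: vmaxMr => //; apply: vrD.
rewrite div_invM ?divE // invrK in Ow.
have -> : x + y = y * (1 + y^-1 * x) by rewrite mulrDr mulr1 div_mulVKr // addrC.
by apply: vmaxMr => //; apply: vrD.
Qed.

Lemma vmaxB x y : vmax x -> vmax y -> vmax (x - y).
Proof. by move=> mx my; apply/vmaxD/vmaxN. Qed.

Lemma vmax1 : ~ vmax 1.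
Proof. by case=> [/eqP|]; rewrite ?oner_eq0 // invr1. Qed.

Lemma vunit1 : vunit 1. Proof. by apply: vunitP => //; apply: vmax1. Qed.

Lemma vunitM x y : vunit x -> vunit y -> vunit (x * y).
Proof.
move=> [x0 Ox Ox'] [y0 Oy Oy']; split; first by rewrite !divE x0.
  exact: OM.
by rewrite div_invM //; apply: OM.
Qed.

Lemma vunitV x : vunit x -> vunit x^-1.
Proof. by move=> [x0 Ox Ox']; split; rewrite ?divE ?invrK. Qed.

Lemma vunitX x k : vunit x -> vunit (x ^+ k).
Proof. by move=> ux; elim: k => [|k IH]; [apply: vunit1 | rewrite exprS; apply: vunitM]. Qed.

Lemma vunitN x : vunit x -> vunit (- x).
Proof. by move=> [x0 Ox Ox']; split; rewrite ?invrN ?oppr_eq0 //; apply: vrN. Qed.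

Lemma vunitJ g x : g != 0 -> vunit x -> vunit (g^-1 * x * g).
Proof.
move=> g0 [x0 Ox Ox']; split; first by rewrite !divE x0 g0.
  exact: (@vrJ _ O).
rewrite -mulrA !div_invM ?divE ?x0 ?g0 // invrK.
exact: (@vrJ _ O).
Qed.

Lemma vunitDm x y : vunit x -> vmax y -> vunit (x + y).
Proof.
move=> ux my; apply: vunitP; first by apply: vrD; [apply: vunit_O | apply: vmax_O].
by move/vmaxB/(_ my); rewrite addrK; apply: vunit_nmax.
Qed.

Definition incongruent x y := ~ vmax (x - y).

Section FiniteResidue.
Variable reps : seq D.
Hypothesis repsO : forall e, e \in reps -> O e.
Hypothesis repsP : forall r, O r -> exists2 e, e \in reps & vmax (r - e).

Definition residue_rep r : D := nth 0 reps (find (fun e => `[< vmax (r - e) >]) reps).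

Lemma residue_repP r : O r ->
  residue_rep r \in reps /\ vmax (r - residue_rep r).
Proof.
move=> Or; have hasr : has (fun e => `[< vmax (r - e) >]) reps.
  by have [e re me] := repsP Or; apply/hasP; exists e => //; apply/asboolP.
by split; [apply: mem_nth; rewrite -has_find | apply/asboolP/(nth_find 0 hasr)].
Qed.

Lemma residue_rep_eq r s : vmax (r - s) -> residue_rep r = residue_rep s.
Proof.
move=> rs; rewrite /residue_rep; congr nth; apply: eq_find => e.
apply/asboolP/asboolP => [re|se].
  by have := vmaxB re rs; rewrite opprB addrC addrA addrNK.
by have := vmaxD rs se; rewrite addrA addrNK.
Qed.

(** The residue ring, when it is finite, is built on a list of representatives:
    this gives the finite type that Wedderburn's theorem expects. *)
Definition residue := seq_sub [seq residue_rep e | e <- reps].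
HB.instance Definition _ := Finite.on residue.

Lemma residue_of_subproof r :
  residue_rep (if `[< O r >] then r else 0) \in [seq residue_rep e | e <- reps].
Proof.
have O' : O (if `[< O r >] then r else 0) by case: asboolP => // _; apply: vr0.
have [rep1 mr] := residue_repP O'.
by apply/mapP; exists (residue_rep (if `[< O r >] then r else 0)) => //; apply: residue_rep_eq.
Qed.

Definition residue_of r : residue := SeqSub (residue_of_subproof r).

Lemma val_residue_of r : O r -> val (residue_of r) = residue_rep r.
Proof. by rewrite /= => Or; case: asboolP. Qed.

Lemma residue_of_eq r s : O r -> O s -> vmax (r - s) -> residue_of r = residue_of s.
Proof.
by move=> Or Os rs; apply/val_inj; rewrite !val_residue_of //; apply: residue_rep_eq.
Qed.

Lemma residue_of_eqP r s : O r -> O s -> residue_of r = residue_of s -> vmax (r - s).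
Proof.
move=> Or Os /(congr1 val); rewrite !val_residue_of // => rs.
have [_ mr] := residue_repP Or; have [_ ms] := residue_repP Os.
by have := vmaxB mr ms; rewrite rs opprB addrA addrNK.
Qed.

Lemma residueW (P : residue -> Prop) :
  (forall r, O r -> P (residue_of r)) -> forall a, P a.
Proof.
move=> Pr a; have /mapP[e ere ea] := valP a.
suff -> : a = residue_of e by apply/Pr/repsO.
by apply/val_inj; rewrite val_residue_of //; apply: repsO.
Qed.

Lemma val_residueO (a : residue) : O (val a).
Proof.
have /mapP[e ere ->] := valP a.
by apply: repsO; case: (residue_repP (repsO ere)).
Qed.

Lemma val_residue_sub r : O r -> vmax (r - val (residue_of r)).
Proof. by move=> Or; rewrite val_residue_of //; case: (residue_repP Or). Qed.

Definition radd (a b : residue) := residue_of (val a + val b).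
Definition rmul (a b : residue) := residue_of (val a * val b).
Definition ropp (a : residue) := residue_of (- val a).

Lemma radd_of r s : O r -> O s ->
  radd (residue_of r) (residue_of s) = residue_of (r + s).
Proof.
move=> Or Os; apply: residue_of_eq; try apply: vrD; try exact: val_residueO => //.
  by [].
  by [].
rewrite -opprB; apply: vmaxN; rewrite opprD addrACA.
by apply: vmaxD; apply: val_residue_sub.
Qed.

Lemma rmul_of r s : O r -> O s ->
  rmul (residue_of r) (residue_of s) = residue_of (r * s).
Proof.
move=> Or Os; apply: residue_of_eq; try apply: OM; try exact: val_residueO => //.
  by [].
  by [].
set r' := val _; set s' := val _.
have -> : r' * s' - r * s = - ((r - r') * s' + r * (s - s')).
  by rewrite mulrBl mulrBr [in RHS]addrC addrA addrNK opprB.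
apply/vmaxN/vmaxD.
  by apply: vmaxMr; [apply: val_residue_sub | apply: val_residueO].
by apply: vmaxMl => //; apply: val_residue_sub.
Qed.

Lemma ropp_of r : O r -> ropp (residue_of r) = residue_of (- r).
Proof.
move=> Or; apply: residue_of_eq; try apply: vrN; try exact: val_residueO => //.
  by [].
by rewrite opprK addrC; apply: val_residue_sub.
Qed.

Local Ltac rsolve := repeat first [apply: vrD | apply: OM | apply: vrN | assumption | exact: vr0].

Fact raddA : associative radd.
Proof.
elim/residueW=> a Oa; elim/residueW=> b Ob; elim/residueW=> c Oc.
by rewrite !radd_of ?addrA //; rsolve.
Qed.
Fact raddC : commutative radd.
Proof. by elim/residueW=> a Oa; elim/residueW=> b Ob; rewrite !radd_of // addrC. Qed.
Fact radd0 : left_id (residue_of 0) radd.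
Proof. by elim/residueW=> a Oa; rewrite radd_of ?add0r //; rsolve. Qed.
Fact raddN : left_inverse (residue_of 0) ropp radd.
Proof. by elim/residueW=> a Oa; rewrite ropp_of // radd_of ?addNr //; rsolve. Qed.

HB.instance Definition _ := GRing.isZmodule.Build residue raddA raddC radd0 raddN.

Fact raddE (a b : residue) : a + b = radd a b. Proof. by []. Qed.

Fact rmulA : associative rmul.
Proof.
elim/residueW=> a Oa; elim/residueW=> b Ob; elim/residueW=> c Oc.
by rewrite !rmul_of ?mulrA //; rsolve.
Qed.
Fact rmul1 : left_id (residue_of 1) rmul.
Proof. by elim/residueW=> a Oa; rewrite rmul_of ?mul1r //; rsolve. Qed.
Fact rmulr1 : right_id (residue_of 1) rmul.
Proof. by elim/residueW=> a Oa; rewrite rmul_of ?mulr1 //; rsolve. Qed.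
Fact rmulDl : left_distributive rmul +%R.
Proof.
elim/residueW=> a Oa; elim/residueW=> b Ob; elim/residueW=> c Oc.
by rewrite !raddE !(rmul_of, radd_of) ?mulrDl //; rsolve.
Qed.
Fact rmulDr : right_distributive rmul +%R.
Proof.
elim/residueW=> a Oa; elim/residueW=> b Ob; elim/residueW=> c Oc.
by rewrite !raddE !(rmul_of, radd_of) ?mulrDr //; rsolve.
Qed.
Fact r1_neq0 : residue_of 1 != residue_of 0.
Proof. by apply/eqP => /(residue_of_eqP O1 vr0); rewrite subr0; apply: vmax1. Qed.

HB.instance Definition _ := GRing.Zmodule_isNzRing.Build residue
  rmulA rmul1 rmulr1 rmulDl rmulDr r1_neq0.
HB.instance Definition _ := FinRing.isNzRing.Build residue.

(** Wedderburn's theorem: the residue ring is a finite ring without zero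
    divisors. *)
Lemma residue_comm r s : O r -> O s -> vmax (r * s - s * r).
Proof.
move=> Or Os; apply: residue_of_eqP; rewrite -?rmul_of //; try exact: OM.
apply: (@finDomain_mulrC residue) => //.
elim/residueW=> a Oa; elim/residueW=> b Ob; rewrite [_ * _]rmul_of //.
move/(residue_of_eqP (OM Oa Ob) vr0); rewrite subr0 => mab.
have [ma|ma] := pselect (vmax a).
  by apply/orP; left; apply/eqP/residue_of_eq => //; [apply: vr0 | rewrite subr0].
apply/orP; right; apply/eqP/residue_of_eq => //; first exact: vr0.
have [a0 _ Oa'] := vunitP Oa ma.
by rewrite subr0 -(div_mulKr divD b a0); apply: vmaxMl.
Qed.

End FiniteResidue.

End Valuation.

(** * Quotients of the multiplicative group *)

Lemma simple_center (L : finGroupType) :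
  simple [set: L]%g -> ~~ abelian [set: L]%g ->
  forall t : L, (forall s, commute t s) -> t = 1%g.
Proof.
move=> /simpleP[_ simL] nab t tC.
have [/trivgP Z1|Z1] := simL _ (center_normal [set: L]).
  by apply/set1P; rewrite -[[set 1%g]]/(1%g : {set L}); apply: (subsetP Z1);
     apply/centerP; split=> [|s _]; rewrite ?inE.
by case/negP: nab; rewrite -{1}Z1 center_abelian.
Qed.

(** A surjection of the multiplicative group of a division ring onto a nonabelian
    finite simple group, extended by an arbitrary value at 0. *)
Structure division_quotient (D : unitRingType) (L : finGroupType) := DivisionQuotient {
  dq_map :> D -> L;
  dq_div : division_ring D;
  dq_mul : forall x y, x != 0 -> y != 0 -> dq_map (x * y) = (dq_map x * dq_map y)%g;
  dq_surj : forall t, exists2 x, x != 0 & dq_map x = t;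
  dq_simple : simple [set: L]%g;
  dq_nonabelian : ~~ abelian [set: L]%g
}.

Section Quotient.
Variables (D : unitRingType) (L : finGroupType) (psi : division_quotient D L).
Implicit Types x y r s : D.

Let divD := dq_div psi.
Let divE := divE divD.
Let psiM := @dq_mul D L psi.
Let psi_surj := dq_surj psi.
Let centerL := simple_center (dq_simple psi) (dq_nonabelian psi).

Lemma psi1 : psi 1 = 1%g.
Proof. by apply: (mulgI (psi 1)); rewrite -psiM ?oner_neq0 ?mulr1 ?mulg1. Qed.

Lemma psiV x : x != 0 -> psi x^-1 = (psi x)^-1%g.
Proof.
move=> x0; apply: (mulgI (psi x)); rewrite mulgV -psiM ?divE //.
by rewrite div_mulrV ?psi1.
Qed.

Lemma psiX x k : x != 0 -> psi (x ^+ k) = (psi x ^+ k)%g.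
Proof.
move=> x0; elim: k => [|k IH]; first by rewrite psi1.
by rewrite exprS expgS psiM ?IH // div_exp_eq0.
Qed.

(** The image of a central element is central in L, hence trivial. *)
Lemma psi_central c : c != 0 -> (forall r, c * r = r * c) -> psi c = 1%g.
Proof.
move=> c0 cC; apply: centerL => t; have [x x0 <-] := psi_surj t.
by rewrite /commute -!psiM // cC.
Qed.

Lemma psiN x : x != 0 -> psi (- x) = psi x.
Proof.
move=> x0; rewrite -mulN1r psiM ?divE // psi_central ?mul1g ?divE // => r.
by rewrite mulN1r mulrN1.
Qed.

(** With w = x^-1 * y, the images of y and x + y are those of w and 1 + w, which
    commute. *)
Lemma psi_add_commute x y : x != 0 -> y != 0 -> x + y != 0 ->
  psi x = 1%g -> commute (psi y) (psi (x + y)).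
Proof.
move=> x0 y0 xy0 px.
have [w xw] : exists w, y = x * w by exists (x^-1 * y); rewrite div_mulVKr.
have w0 : w != 0 by move: y0; rewrite xw !divE => /andP[].
have xw1 : x + y = x * (1 + w) by rewrite mulrDr mulr1 -xw.
have w10 : 1 + w != 0 by move: xy0; rewrite xw1 !divE => /andP[].
rewrite xw1 xw !psiM // px !mul1g /commute -!psiM //.
by rewrite mulrDl mulrDr mulr1 mul1r.
Qed.

Lemma psi_sum1_commute x y : x != 0 -> y != 0 -> x + y != 0 ->
  psi (x + y) = 1%g -> commute (psi x) (psi y).
Proof.
move=> x0 y0 xy0 pxy; have := @psi_add_commute (x + y) (- y).
by rewrite addrK divE psiN // => H; apply/commute_sym/H.
Qed.

End Quotient.

(** The last field says that 1 plus the maximal ideal is contained in the kernel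
    of psi, so that psi is defined on the units of the residue division ring. *)
Structure compatible_ring D L (psi : division_quotient D L) := CompatibleRing {
  cr_val :> valuation_ring D;
  cr_max : forall r, r != 0 -> ~ cr_val r^-1 -> psi (1 + r) = 1%g
}.

Section Compatible.
Variables (D : unitRingType) (L : finGroupType) (psi : division_quotient D L).
Variable O : compatible_ring psi.
Implicit Types x y : D.

Let divD := dq_div psi.
Let divE := divE divD.

Lemma psi_addm x y : vunit O x -> vmax O y -> psi (x + y) = psi x.
Proof.
move=> ux my; have [x0 Ox Ox'] := ux; have my' := vmaxMl Ox' my.
have uxy := vunitDm ux my.
have xy : x + y = x * (1 + x^-1 * y).
  by rewrite mulrDr mulr1 div_mulVKr.
rewrite xy dq_mul //; last first.
  by move: (vunit_neq0 uxy); rewrite xy !divE => /andP[].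
suff -> : psi (1 + x^-1 * y) = 1%g by rewrite mulg1.
have [->|w0] := eqVneq (x^-1 * y) 0; first by rewrite addr0 psi1.
by apply: (cr_max (c := O) w0); case: my' => [/eqP|]; first by rewrite (negbTE w0).
Qed.

Lemma vunit_add x y : vunit O x -> vunit O y -> psi x <> psi y -> vunit O (x + y).
Proof.
move=> ux uy nxy; apply: vunitP; first by apply: vrD; apply: vunit_O.
move=> mxy; have := psi_addm (vunitN uy) mxy.
by rewrite addrC addrK psiN ?(vunit_neq0 uy).
Qed.

End Compatible.

(** * Every element of a residue division ring is a difference of kernel elements *)

Section Thick.
Variables (D : unitRingType) (L : finGroupType) (psi : division_quotient D L).
Variable O : compatible_ring psi.
Implicit Types (x y r s t : D) (A B : D -> Prop) (F : seq D).

Let divD := dq_div psi.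
Let divE := divE divD.
Let psiM := @dq_mul D L psi.

(** A set is thick if it contains a translate of each finite set.  A set with a thick
    finite union of translates is piecewise syndetic; these sets replace the sets
    of positive density, because a finite colouring has a piecewise syndetic
    class ([thick_color]). *)
Definition thick A :=
  forall F, (forall e, e \in F -> O e) -> exists2 t, O t & forall e, e \in F -> A (t + e).

Definition translates F A r := exists2 f, f \in F & A (r + f).

(** If B contains no translate of the finite set F, then every translate of F meets
    A, so that finitely many translates of A cover a thick set. *)
Lemma thick_split A B : thick (fun r => A r \/ B r) ->
  thick B \/ exists2 F : seq D, (forall f, f \in F -> O f) & thick (translates F A).
Proof.
move=> AB; have [|nB] := pselect (thick B); [by left | right].
have [F FO nF] : exists2 F : seq D, (forall f, f \in F -> O f)
    & forall t, O t -> exists2 e, e \in F & ~ B (t + e).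
  apply: contrapT => nF; apply: nB => F FO; apply: contrapT => nt; apply: nF.
  exists F => // t Ot; apply: contrapT => ne; apply: nt; exists t => // e Fe.
  by apply: contrapT => nB; apply: ne; exists e.
exists F => // E EO.
have [|t Ot tAB] := AB [seq h + e | h <- E, e <- F].
  by move=> _ /allpairsP[[h e] [/EO Oh /FO Oe ->]]; apply: vrD.
exists t => // h Eh; have [e Fe nBe] := nF (t + h) (vrD Ot (EO h Eh)).
exists e => //; rewrite -addrA in nBe *.
by case: (tAB (h + e)) => //; apply/allpairsP; exists (h, e).
Qed.

Lemma thick_color (C : eqType) (col : D -> C) (cs : seq C) :
  thick (fun r => col r \in cs) -> exists c (F : seq D),
  [/\ c \in cs, forall f, f \in F -> O f & thick (translates F (fun r => col r = c))].
Proof.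
elim: cs => [|c cs IH] thc.
  have [|t _ /(_ 0)] := thc [:: 0]; last by rewrite mem_head => /(_ isT).
  by move=> e; rewrite inE => /eqP ->; apply: vr0.
have [|thcs|[F FO thF]] := @thick_split (fun r => col r = c) (fun r => col r \in cs).
- move=> F FO; have [t Ot tF] := thc F FO; exists t => // e /tF.
  by rewrite inE => /orP[/eqP|]; [left | right].
- have [c' [F [cc' FO thF]]] := IH thcs; exists c', F; split=> //.
  by rewrite inE cc' orbT.
- by exists c, F; rewrite mem_head.
Qed.

(** A maximal family of incongruent elements is a system of representatives. *)
Lemma finite_residue_commutes k :
  (forall F, (forall e, e \in F -> O e) -> pairwise (fun x y => `[< incongruent O x y >]) F ->
     (size F <= k)%N) ->
  forall r s, O r -> O s -> vmax O (r * s - s * r).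
Proof.
move=> Fk; have [F FO Fc] : exists2 F : seq D, (forall e, e \in F -> O e)
    & forall r, O r -> exists2 e, e \in F & vmax O (r - e).
  apply: contrapT => nF.
  have /(_ k.+1)[F [FO Fp sF]] j : exists F : seq D, [/\ forall e, e \in F -> O e,
      pairwise (fun x y => `[< incongruent O x y >]) F & size F = j].
    elim: j => [|j [F [FO Fp <-]]]; first by exists nil.
    have [r Or rF] : exists2 r, O r & forall e, e \in F -> ~ vmax O (r - e).
      apply: contrapT => nr; apply: nF; exists F => // r Or.
      apply: contrapT => ne; apply: nr; exists r => // e Fe re.
      by apply: ne; exists e.
    exists (r :: F); split=> //=.
      by move=> e; rewrite inE => /orP[/eqP ->|/FO].
    by rewrite Fp andbT; apply/allP => e Fe; apply/asboolP/rF.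
  by have := Fk F FO Fp; rewrite sF ltnn.
exact: residue_comm FO Fc.
Qed.

Hypothesis unit_surj : forall u, exists2 x, vunit O x & psi x = u.

(** The image of the units is not abelian, and it only depends on the residue
    ring. *)
Lemma residue_infinite k : exists F : seq D, [/\ forall e, e \in F -> O e,
  pairwise (fun x y => `[< incongruent O x y >]) F & (k < size F)%N].
Proof.
apply: contrapT => nF; case/negP: (dq_nonabelian psi).
have comm := @finite_residue_commutes k; apply/centsP => u _ v _.
have [x ux <-] := unit_surj u; have [y uy <-] := unit_surj v.
have {}comm : vmax O (x * y - y * x).
  apply: comm; try exact: vunit_O.
  move=> F FO Fp; rewrite leqNgt; apply/negP => kF; apply: nF.
  by exists F.
have := psi_addm (vunitM uy ux) comm.
have [[x0 _ _] [y0 _ _]] := (ux, uy).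
by rewrite addrC addrNK !psiM.
Qed.

(** Some coset of the kernel is piecewise syndetic, that is, finitely many
    translates of it, say by F, cover a thick set (the maximal ideal cannot play
    this role, since it has infinite index).  Multiplying by units, the same holds
    for every coset.  A translate of a finite set E is thus coloured by F, once
    for each element of L; if E is large, two elements of E get the same colours,
    so that their difference, multiplied by any unit, is a difference of two
    elements of one coset.  A suitable unit turns this difference into a. *)
Lemma unit_difference a : vunit O a ->
  exists n, [/\ vunit O n, psi n = 1%g, vunit O (a + n) & psi (a + n) = 1%g].
Proof.
move=> ua; pose col r := if `[< vmax O r >] then None else Some (psi r).
have [|c [F [_ FO thF]]] := @thick_color _ col (enum {: option L}).
  by move=> F _; exists 0; [apply: vr0 | move=> e _; rewrite mem_enum].
have sel (E : seq D) : (forall e, e \in E -> O e) -> exists t (chi : 'I_(size E) -> 'I_(size F)),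
    forall i : 'I_(size E), O (t + E`_i + F`_(chi i)) /\ col (t + E`_i + F`_(chi i)) = c.
  move=> EO; have [t Ot tE] := thF E EO; exists t.
  suff /choice[chi chiP] : forall i : 'I_(size E), exists j : 'I_(size F),
    O (t + E`_i + F`_j) /\ col (t + E`_i + F`_j) = c by exists chi.
  move=> i.
  have [f Ff fc] := tE _ (mem_nth 0 (ltn_ord i)).
  have jF : (index f F < size F)%N by rewrite index_mem.
  exists (Ordinal jF); rewrite /= nth_index //; split=> //.
  by apply/vrD/FO => //; apply/vrD/EO => //; apply: mem_nth.
(* There are size F ^ #|L| colourings of an element, and size F translates of the
   maximal ideal. *)
have [E [EO Ep FE]] := residue_infinite (size F ^ #|L| + size F).
have inc (i j : 'I_(size E)) : i != j -> vunit O (E`_i - E`_j).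
  move=> ij; apply: vunitP; first by apply: vrB; apply/EO/mem_nth.
  move/(pairwiseP 0): Ep => Ep mij; case: (ltngtP i j) => ij'.
  - by have /asboolP := Ep _ _ (ltn_ord i) (ltn_ord j) ij'; apply.
  - have /asboolP := Ep _ _ (ltn_ord j) (ltn_ord i) ij'; apply.
    by rewrite -opprB; apply: vmaxN.
  - by rewrite (val_inj ij') eqxx in ij.
have sub4 t x y f : t + x + f - (t + y + f) = x - y :> D.
  by rewrite opprD addrACA subrr addr0 opprD addrACA subrr add0r.
case: c thF sel => [u|] thF sel; last first.
  have [t [chi chiP]] := sel E EO; have /injectivePn[i [j ij cij]] : ~~ injectiveb chi.
    apply/negP => /injectiveP/leq_card; rewrite !card_ord leqNgt.
    by rewrite (leq_ltn_trans _ FE) // leq_addl.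
  have m (k : 'I_(size E)) : vmax O (t + E`_k + F`_(chi k)).
    by have [_] := chiP k; rewrite /col; case: asboolP.
  case: (vunit_nmax (inc i j ij)).
  by have := vmaxB (m i) (m j); rewrite cij sub4.
have colg v : exists g (chi : 'I_(size E) -> 'I_(size F)), [/\ vunit O g, psi g = v
    & forall i j : 'I_(size E), chi i = chi j -> exists h1 h2,
      [/\ vunit O h1, psi h1 = u, vunit O h2, psi h2 = u & g * (E`_i - E`_j) = h1 - h2]].
  have [g ug <-] := unit_surj v; pose Eg := [seq g * e | e <- E].
  have sEg : size E = size Eg by rewrite size_map.
  have [|t [chi chiP]] := sel Eg.
    by move=> _ /mapP[e Ee ->]; apply: vrM (vunit_O ug) (EO e Ee).
  exists g, (fun i => chi (cast_ord sEg i)); split=> // i j cij.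
  have H (k : 'I_(size E)) : vunit O (t + g * E`_k + F`_(chi (cast_ord sEg k))) /\
      psi (t + g * E`_k + F`_(chi (cast_ord sEg k))) = u.
    have := chiP (cast_ord sEg k); rewrite /= (nth_map 0) // => -[Ok].
    by rewrite /col; case: asboolP => // mk [<-]; split=> //; apply: vunitP.
  have [[ui pi] [uj pj]] := (H i, H j).
  by do 2 eexists; split; [exact: ui | exact: pi | exact: uj | exact: pj |];
    rewrite cij sub4 mulrBr.
have /choice[g /choice[chi chiP]] := colg.
have /injectivePn[i [j ij cij]] :
    ~~ injectiveb (fun i : 'I_(size E) => [ffun v => chi v i]).
  apply/negP => /injectiveP/leq_card; rewrite card_ffun !card_ord leqNgt.
  by rewrite (leq_ltn_trans _ FE) // leq_addr.
pose d := E`_i - E`_j; have ud : vunit O d := inc i j ij.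
pose v := (u * psi a * (psi d)^-1)%g; have [ug gv _] := chiP v.
have [h1 [h2 [u1 p1 u2 p2 gd]]] : exists h1 h2,
    [/\ vunit O h1, psi h1 = u, vunit O h2, psi h2 = u & g v * d = h1 - h2].
  by have [_ _] := chiP v; apply; have /ffunP/(_ v) := cij; rewrite !ffunE.
have [a0 d0] := (vunit_neq0 ua, vunit_neq0 ud).
have [h10 h20] := (vunit_neq0 u1, vunit_neq0 u2).
(* a and 1 - h1^-1 h2 = h1^-1 (g v) d have the same image. *)
pose n := a * (h1^-1 * (g v * d))^-1.
have ue : vunit O (h1^-1 * (g v * d)) by apply/vunitM/vunitM => //; apply: vunitV.
have e0 := vunit_neq0 ue.
have un : vunit O n by apply/vunitM/vunitV.
have pn : psi n = 1%g.
  have g0 := vunit_neq0 ug.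
  rewrite /n psiM ?divE ?h10 ?g0 // psiV ?divE ?h10 ?g0 //.
  rewrite psiM ?divE ?h10 ?g0 // psiV // psiM // p1 gv /v.
  by rewrite mulgVK mulKg mulgV.
have Ea : a = n - n * (h1^-1 * h2).
  rewrite -{1}(mulr1 n) -mulrBr -{1}(div_mulVr divD h10) -mulrBr -gd /n.
  by rewrite div_mulrVK.
clearbody n; exists (n * (h1^-1 * h2)); split.
- by apply/vunitM/vunitM => //; apply: vunitV.
- by rewrite !psiM ?divE ?h10 ?h20 ?(vunit_neq0 un) // psiV // pn p1 p2 mul1g mulVg.
- by rewrite {1}Ea subrK.
- by rewrite {1}Ea subrK.
Qed.

End Thick.

(** * The kernel among the units of a valuation ring *)

Section KernelUnits.
Variables (D : unitRingType) (L : finGroupType) (psi : division_quotient D L).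
Variable O : compatible_ring psi.
Implicit Types (x y : D).

Let divD := dq_div psi.

Definition ker_unit_pred : {pred D} := fun x => `[< vunit O x /\ psi x = 1%g >].
(** The units of O with trivial image, as a group: this is N relatively to O. *)
Definition ker_unit := {x : D | ker_unit_pred x}.
HB.instance Definition _ := Choice.on ker_unit.
Definition ker_unit_val (n : ker_unit) : D := val n.
Local Notation "n %:D" := (ker_unit_val n) (at level 2, format "n %:D").
Implicit Types n m : ker_unit.

Lemma ker_vunit n : vunit O n%:D. Proof. by have /asboolP[] := valP n. Qed.
Lemma ker_psi n : psi n%:D = 1%g. Proof. by have /asboolP[] := valP n. Qed.
Lemma ker_neq0 n : n%:D != 0. Proof. exact: vunit_neq0 (ker_vunit n). Qed.

Fact ker_unit1_subproof : ker_unit_pred 1.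
Proof. by apply/asboolP; split; [apply: vunit1 | apply: psi1]. Qed.

Definition ker_one : ker_unit := exist _ 1 ker_unit1_subproof.
Definition to_ker (x : D) : ker_unit := insubd ker_one x.

Lemma to_kerE x : vunit O x -> psi x = 1%g -> (to_ker x)%:D = x.
Proof. by move=> ux px; rewrite /to_ker /ker_unit_val val_insubd ifT //; apply/asboolP. Qed.

Definition ker_mul n m := to_ker (n%:D * m%:D).
Definition ker_inv n := to_ker n%:D^-1.

Lemma ker_mulE n m : (ker_mul n m)%:D = n%:D * m%:D.
Proof.
apply: to_kerE; first by apply: vunitM; apply: ker_vunit.
by rewrite dq_mul ?ker_neq0 // !ker_psi mulg1.
Qed.

Lemma ker_invE n : (ker_inv n)%:D = n%:D^-1.
Proof.
apply: to_kerE; first by apply: vunitV; apply: ker_vunit.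
by rewrite psiV ?ker_neq0 // ker_psi invg1.
Qed.

Lemma ker_inj n m : n%:D = m%:D -> n = m. Proof. exact: val_inj. Qed.

Fact ker_mulA : associative ker_mul.
Proof. by move=> a b c; apply: ker_inj; rewrite !ker_mulE mulrA. Qed.
Fact ker_mul1g : left_id ker_one ker_mul.
Proof. by move=> a; apply: ker_inj; rewrite ker_mulE mul1r. Qed.
Fact ker_mulg1 : right_id ker_one ker_mul.
Proof. by move=> a; apply: ker_inj; rewrite ker_mulE mulr1. Qed.
Fact ker_mulVg : left_inverse ker_one ker_inv ker_mul.
Proof. by move=> a; apply: ker_inj; rewrite ker_mulE ker_invE div_mulVr ?ker_neq0. Qed.
Fact ker_mulgV : right_inverse ker_one ker_inv ker_mul.
Proof. by move=> a; apply: ker_inj; rewrite ker_mulE ker_invE div_mulrV ?ker_neq0. Qed.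

HB.instance Definition _ := isGroup.Build ker_unit
  ker_mulA ker_mul1g ker_mulg1 ker_mulVg ker_mulgV.

Lemma ker1E : (1%g : ker_unit)%:D = 1. Proof. by []. Qed.
Lemma kerME n m : (n * m)%g%:D = n%:D * m%:D. Proof. exact: ker_mulE. Qed.
Lemma kerVE n : (n^-1)%g%:D = n%:D^-1. Proof. exact: ker_invE. Qed.
Lemma kerXE n k : (n ^+ k)%g%:D = n%:D ^+ k.
Proof. by elim: k => [|k IH]; rewrite ?ker1E // expgS kerME IH exprS. Qed.

End KernelUnits.

Notation "n %:D" := (ker_unit_val n) (at level 2, format "n %:D") : ring_scope.

(** * Comparability of the sets N(a) *)

Section Comparison.
Variables (D : unitRingType) (L : finGroupType) (psi : division_quotient D L).
Variable O : compatible_ring psi.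
Implicit Types (a b c : D) (x y : L) (n m k : ker_unit O).

Let divD := dq_div psi.
Let psiM := @dq_mul D L psi.
Let u0 := @vunit_neq0 D O.

(** Membership of n in the set N(a) described above. *)
Definition addker a n := psi (a + n%:D) = 1%g.

Lemma vunit_addker a n : vunit O a -> psi a <> 1%g -> vunit O (a + n%:D).
Proof. by move=> ua pa; apply: vunit_add => //; [apply: ker_vunit | rewrite ker_psi]. Qed.

Lemma addker_mull m a n : vunit O a -> psi a <> 1%g ->
  addker (m%:D * a) (m * n)%g <-> addker a n.
Proof.
move=> ua pa; rewrite /addker kerME -mulrDr psiM ?ker_neq0 ?ker_psi ?mul1g //.
exact/u0/vunit_addker.
Qed.

Lemma addker_mulr m a n : vunit O a -> psi a <> 1%g ->
  addker (a * m%:D) (n * m)%g <-> addker a n.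
Proof.
move=> ua pa; rewrite /addker kerME -mulrDl psiM ?ker_neq0 ?ker_psi ?mulg1 //.
exact/u0/vunit_addker.
Qed.

Lemma addker_commute a n : vunit O a -> psi a <> 1%g -> commute (psi a) (psi (a + n%:D)).
Proof.
move=> ua pa; rewrite addrC; apply: psi_add_commute; rewrite ?ker_psi ?ker_neq0 //.
  exact: u0 ua.
by rewrite addrC; apply/u0/vunit_addker.
Qed.

Lemma vunit_add_commute a b : vunit O a -> vunit O b -> psi a = 1%g -> psi b <> 1%g ->
  commute (psi b) (psi (a + b)).
Proof.
move=> ua ub pa pb; apply: psi_add_commute => //; try by apply: u0.
by apply: u0; apply: vunit_add => // pab; apply: pb; rewrite -pab.
Qed.

Lemma far2_neq x y : far2 x y -> x <> 1%g -> x <> y.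
Proof. by move=> xy x1 exy; apply/x1/xy; rewrite -?exy. Qed.

Lemma far2_sum1 a b : vunit O a -> vunit O b -> psi a <> 1%g ->
  far2 (psi a) (psi b) -> psi (a + b) <> 1%g.
Proof.
move=> ua ub pa ab pab; apply: (pa); apply: (ab) => //.
apply: psi_sum1_commute => //; try by apply: u0.
by apply: u0; apply: vunit_add => //; apply: far2_neq.
Qed.

(** If n is in N(a + b) but not in N(a), then (a + n) + b is in N, so that the image
    of a + n commutes with those of a and b. *)
Lemma far2_add_sub a b n : vunit O a -> vunit O b -> psi a <> 1%g -> psi b <> 1%g ->
  far2 (psi a) (psi b) -> addker (a + b) n -> addker a n /\ addker b n.
Proof.
suff H c d : vunit O c -> vunit O d -> psi c <> 1%g -> psi d <> 1%g ->
    far2 (psi c) (psi d) -> addker (c + d) n -> addker c n.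
  move=> ua ub pa pb ab abn; split; first exact: (H a b).
  apply: (H b a) => //; last by rewrite addrC.
  by move=> s bs sa; apply: ab; apply: commute_sym.
move=> uc ud pc pd cd cdn; apply: contrapT => nc.
have ucn := vunit_addker n uc pc; apply: nc; apply: (cd).
  exact: addker_commute.
have E : c + d + n%:D = (c + n%:D) + d by rewrite addrAC.
apply: psi_sum1_commute; try by apply: u0.
  rewrite -E; apply/u0/vunit_addker.
    by apply: vunit_add => //; apply: far2_neq.
  exact: far2_sum1.
by rewrite -E.
Qed.

(** The image of a + b + n is at distance at most 1 from those of b and a + b, as
    a + n and n are in N. *)
Lemma far2_add_out a b n : vunit O a -> vunit O b -> psi a <> 1%g -> psi b <> 1%g ->
  far2 (psi a) (psi b) -> addker a n -> ~ addker b n ->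
  [/\ psi (a + b) <> 1%g, psi (a + b + n%:D) <> 1%g, commute (psi b) (psi (a + b + n%:D))
    & commute (psi (a + b)) (psi (a + b + n%:D))].
Proof.
move=> ua ub pa pb ab an nbn.
have ueab : vunit O (a + b) by apply: vunit_add => //; apply: far2_neq.
have p1 := far2_sum1 ua ub pa ab; split=> //.
- by move=> abn; apply: nbn; case: (far2_add_sub ua ub pa pb ab abn).
- rewrite addrAC; apply: vunit_add_commute => //; exact: vunit_addker.
- exact: addker_commute.
Qed.

(** N(a) and N(b) are comparable for inclusion whenever the images of a and b are x
    and y: there are no n in N(a) only and m in N(b) only. *)
Definition comparable_cosets x y := forall a b n m, vunit O a -> vunit O b ->
  psi a = x -> psi b = y -> addker a n -> ~ addker a m -> addker b m -> addker b n.

(** Otherwise the images of a, a + b + m, a + b, a + b + n and b form a path. *)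
Lemma far4_comparable x y : x <> 1%g -> y <> 1%g -> far4 x y -> comparable_cosets x y.
Proof.
move=> x1 y1 xy a b n m ua ub pa pb an nam bm; apply: contrapT => nbn.
have ab : far2 (psi a) (psi b) by rewrite pa pb; apply/far3_far2/far4_far3.
have ba : far2 (psi b) (psi a).
  by move=> s bs sa; apply: ab; apply: commute_sym.
rewrite -pa in x1; rewrite -pb in y1.
have [c1 n1 bn cn] := far2_add_out ua ub x1 y1 ab an nbn.
have [_ m1 am cm] := far2_add_out ub ua y1 x1 ba bm nam.
rewrite ![b + a]addrC -pa -pb in m1 am cm xy.
by case: (xy _ _ _ am (commute_sym cm) cn (commute_sym bn)).
Qed.

Section Balanced.
Variables (x y : L).
Hypotheses (x1 : x <> 1%g) (y1 : y <> 1%g) (far_xy : far3 x y) (far_y_xy : far2 y (x * y)%g).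

Let xy1 : (x * y)%g <> 1%g.
Proof.
move=> xy; apply/y1/far_y_xy => //; rewrite xy; exact: commute1.
Qed.

(** If n = 1 + a then n * b = b + a * b is the sum of elements whose images are
    far apart. *)
Lemma addker_mul_sub a b k n : vunit O a -> vunit O b -> psi a = x -> psi b = y ->
  1 + a = n%:D -> addker (n%:D * b) k -> addker b k /\ addker (a * b) k.
Proof.
move=> ua ub pa pb an; rewrite -an mulrDl mul1r.
have pab : psi (a * b) = (x * y)%g.
  by rewrite psiM ?(u0 ua) ?(u0 ub) // pa pb.
by apply: far2_add_sub; rewrite ?pab ?pb //; apply: vunitM.
Qed.

(** Apply the previous lemma to a, with n = 1 + a, and to a' = - n^-1 * a, for which
    1 + a' = n^-1: N(b) is contained in N(n * b), which is contained in N(a * b). *)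
Lemma addker_mul a b k : vunit O a -> vunit O b -> psi a = x -> psi b = y ->
  addker a (1%g : ker_unit O) -> addker b k -> addker (a * b) k.
Proof.
move=> ua ub pa pb a1 bk.
have un : vunit O (1 + a) by rewrite addrC; apply: (vunit_addker 1%g); rewrite ?pa.
pose n := to_ker O (1 + a).
have nE : 1 + a = n%:D by rewrite /n to_kerE // addrC.
suff : addker (n%:D * b) k by case/(addker_mul_sub ua ub pa pb nE).
have nV : 1 + - (n^-1%g%:D * a) = n^-1%g%:D.
  by rewrite kerVE -{1}(div_mulVr divD (ker_neq0 n)) -mulrBr -nE addrK mulr1.
have ua' : vunit O (- (n^-1%g%:D * a)).
  by apply/vunitN/vunitM => //; apply: ker_vunit.
case: (@addker_mul_sub _ (n%:D * b) k _ ua' _ _ _ nV) => //.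
- by apply: vunitM => //; apply: ker_vunit.
- rewrite psiN ?psiM ?ker_psi ?mul1g //; try exact: ker_neq0; try exact: u0 ua.
  by apply/u0/vunitM => //; apply: ker_vunit.
- by rewrite psiM ?ker_psi ?mul1g //; [apply: ker_neq0 | apply: u0 ub].
- by rewrite kerVE div_mulKr ?ker_neq0.
Qed.

(** Otherwise the image s of a * b + b + k is not trivial and commutes with those
    of b and a * b + b = (a + 1) * b, hence with the image q of a + 1; this gives
    the path from x to y through q and s. *)
Lemma addker_mul_out a b k : vunit O a -> vunit O b -> psi a = x -> psi b = y ->
  ~ addker a (1%g : ker_unit O) -> addker (a * b) k -> addker b k.
Proof.
move=> ua ub pa pb na1 abk; apply: contrapT => nbk.
have pa1 : psi a <> 1%g by rewrite pa.
have pb1 : psi b <> 1%g by rewrite pb.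
have a0 := u0 ua; have b0 := u0 ub.
have ua1 : vunit O (a + 1) by apply: (vunit_addker 1%g).
have pab : psi (a * b) = (x * y)%g by rewrite psiM // pa pb.
have uab : vunit O (a * b) by apply: vunitM.
have far_ab : far2 (psi (a * b)) (psi b).
  by rewrite pab pb => s ? ?; apply: far_y_xy; apply: commute_sym.
have pab1 : psi (a * b) <> 1%g by rewrite pab.
have [_ s1 bs ds] := far2_add_out uab ub pab1 pb1 far_ab abk nbk.
have E : a * b + b = (a + 1) * b by rewrite mulrDl mul1r.
set s := psi (_ + k%:D) in s1 bs ds.
rewrite E psiM ?(u0 ua1) // pb in ds; rewrite pb in bs.
set q := psi _ in ds.
have qs : commute q s.
  have := commuteM (commute_sym ds) (commuteV (commute_sym bs)).
  by rewrite mulgK; apply: commute_sym.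
have xq : commute x q by rewrite -pa; apply: (@addker_commute a 1%g).
by case: (far_xy xq qs (commute_sym bs)).
Qed.

(** If n is in N(a) and m is not, the two previous lemmas, for n^-1 * a and for
    m^-1 * a, squeeze N(a * b) between n N(b) and m N(b). *)
Lemma far3_comparable : comparable_cosets x y.
Proof.
move=> a b n m ua ub pa pb an nam bm.
have pa1 : psi a <> 1%g by rewrite pa.
have pb1 : psi b <> 1%g by rewrite pb.
have a0 := u0 ua; have b0 := u0 ub.
have pk k c : c != 0 -> psi (k%:D * c) = psi c by move=> ?; rewrite psiM ?ker_neq0 // ker_psi mul1g.
have uk k c : vunit O c -> vunit O (k%:D * c) by move=> uc; apply: vunitM => //; apply: ker_vunit.
have shift k c d : vunit O c -> psi c <> 1%g -> addker (k^-1%g%:D * c) d <-> addker c (k * d)%g.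
  by move=> uc pc; have := addker_mull k^-1%g (k * d)%g uc pc; rewrite mulKg.
have step1 : addker (n^-1%g%:D * a * (m^-1%g%:D * b)) 1%g.
  apply: addker_mul; rewrite ?pk //; try exact: uk.
    by apply/shift; rewrite ?mulg1.
  by apply/shift; rewrite ?mulg1.
have uab : vunit O (a * (m^-1%g%:D * b)) by apply/vunitM/uk.
have pab : psi (a * (m^-1%g%:D * b)) = (x * y)%g.
  by rewrite psiM ?(u0 (uk _ _ ub)) // pk // pa pb.
have step2 : addker (m^-1%g%:D * a * (m^-1%g%:D * b)) (m^-1 * n)%g.
  rewrite -mulrA; apply/shift; rewrite ?pab // mulVKg -[n]mulg1.
  by apply/shift; rewrite ?pab // mulrA.
have : addker (m^-1%g%:D * b) (m^-1 * n)%g.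
  apply: addker_mul_out step2; rewrite ?pk //; try exact: uk.
  by move/(shift _ _ _ ua pa1); rewrite mulg1.
by move/(shift _ _ _ ub pb1); rewrite mulVKg.
Qed.
End Balanced.
End Comparison.

(** * The preorder on the kernel *)

Section LeveledOrder.
Variables (D : unitRingType) (L : finGroupType) (psi : division_quotient D L).
Variable O : compatible_ring psi.
Implicit Types (a b c g : D) (x y w : L) (n m k : ker_unit O).

Let divD := dq_div psi.
Let divE := divE divD.
Let psiM := @dq_mul D L psi.
Let u0 := @vunit_neq0 D O.

Definition conj_ker g n : ker_unit O := to_ker O (g^-1 * n%:D * g).

Lemma conj_kerE g n : g != 0 -> (conj_ker g n)%:D = g^-1 * n%:D * g.
Proof.
move=> g0; apply: to_kerE; first by apply/vunitJ/ker_vunit.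
by rewrite !psiM ?divE ?g0 ?ker_neq0 // psiV // ker_psi mulg1 mulVg.
Qed.

(** The outcome of the combinatorics: a translation invariant total preorder on N,
    nontrivial, insensitive to the maximal ideal, invariant under conjugation by
    the kernel of psi in D, and such that 1 + n is equivalent to 1 when n exceeds
    some om.
    For a valuation such that N contains 1 plus the maximal ideal, one may take
    om = 1. *)
Record leveled_order (le : ker_unit O -> ker_unit O -> Prop) : Prop := LeveledOrder {
  lo_order : group_order le;
  lo_gt1 : exists n, ~ le n 1%g;
  lo_level : exists2 om, le 1%g om & forall n, ~ le n om ->
    exists m, [/\ 1 + n%:D = m%:D, le m 1%g & le 1%g m];
  lo_max : forall h n m, vmax O h -> n%:D + h = m%:D -> le n m;
  lo_conj : forall g n m, g != 0 -> psi g = 1%g -> le n m ->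
    le (conj_ker g n) (conj_ker g m)
}.

(** The sets N(b) are meant to be initial segments: for a valuation, a + n has the
    image of n if n has smaller value than a, and the image of a if n has larger
    value. *)
Definition add_le w n m :=
  forall b, vunit O b -> psi b = w -> addker b m -> addker b n.

Lemma add_le_trans w m n k : add_le w n m -> add_le w m k -> add_le w n k.
Proof. by move=> nm mk b ub pb /(mk b ub pb); apply: nm. Qed.

Lemma add_le_mul2l w k n m : w <> 1%g -> add_le w n m -> add_le w (k * n)%g (k * m)%g.
Proof.
move=> w1 nm b ub pb.
have ukb : vunit O (k^-1%g%:D * b) by apply: vunitM => //; apply: ker_vunit.
have pkb : psi (k^-1%g%:D * b) = w by rewrite psiM ?ker_neq0 ?(u0 ub) // ker_psi mul1g.
have nb1 : psi b <> 1%g by rewrite pb.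
move=> /(addker_mull k^-1%g _ ub nb1); rewrite mulKg => /(nm _ ukb pkb) kn.
by apply/(addker_mull k^-1%g _ ub nb1); rewrite mulKg.
Qed.

Lemma add_le_mul2r w k n m : w <> 1%g -> add_le w n m -> add_le w (n * k)%g (m * k)%g.
Proof.
move=> w1 nm b ub pb.
have ukb : vunit O (b * k^-1%g%:D) by apply: vunitM => //; apply: ker_vunit.
have pkb : psi (b * k^-1%g%:D) = w by rewrite psiM ?ker_neq0 ?(u0 ub) // ker_psi mulg1.
have nb1 : psi b <> 1%g by rewrite pb.
move=> /(addker_mulr k^-1%g _ ub nb1); rewrite mulgK => /(nm _ ukb pkb) kn.
by apply/(addker_mulr k^-1%g _ ub nb1); rewrite mulgK.
Qed.

Lemma not_add_le w n m : ~ add_le w n m ->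
  exists b, [/\ vunit O b, psi b = w, addker b m & ~ addker b n].
Proof.
move=> nm; apply: contrapT => nb; apply: nm => b ub pb bm.
by apply: contrapT => bn; apply: nb; exists b.
Qed.

Lemma comparable_sym x y : comparable_cosets O x y -> comparable_cosets O y x.
Proof.
move=> xy a b n m ua ub pa pb an nam bm; apply: contrapT => nbn.
exact/nam/(xy b a m n).
Qed.

Lemma comparable_add_le x y n m : comparable_cosets O x y ->
  (exists a, [/\ vunit O a, psi a = x, addker a n & ~ addker a m]) -> add_le y n m.
Proof. by move=> xy [a [ua pa an nam]] b ub pb; apply: (xy a b). Qed.

(** Elements that are incomparable for y cannot be separated by any N(a) with a in
    the coset of x.  If the two preorders were not total, a product of an
    incomparable pair for x and one for y would be incomparable for y but not
    equivalent for x. *)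
Lemma add_le_total x y : x <> 1%g -> y <> 1%g -> comparable_cosets O x y ->
  (forall n m, add_le x n m \/ add_le x m n) \/ (forall n m, add_le y n m \/ add_le y m n).
Proof.
move=> x1 y1 xy.
have incomparable v w n m : comparable_cosets O w v -> ~ add_le v n m -> ~ add_le v m n ->
    add_le w n m /\ add_le w m n.
  move=> wv nnm nmn; split; apply: (comparable_add_le (comparable_sym wv)).
    by have [b [? ? ? ?]] := not_add_le nmn; exists b.
  by have [b [? ? ? ?]] := not_add_le nnm; exists b.
have total w : ~ (forall n m, add_le w n m \/ add_le w m n) ->
    exists n m, ~ add_le w n m /\ ~ add_le w m n.
  move=> nt; apply: contrapT => ne; apply: nt => n m.
  have [|nnm] := pselect (add_le w n m); first by left.
  have [|nmn] := pselect (add_le w m n); first by right.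
  by case: ne; exists n, m.
have [|/total[m1 [m2 [m12 m21]]]] :=
  pselect (forall n m, add_le x n m \/ add_le x m n); first by left.
have [|/total[n1 [n2 [n12 n21]]]] :=
  pselect (forall n m, add_le y n m \/ add_le y m n); first by right.
have [xn12 xn21] := incomparable _ _ _ _ xy n12 n21.
have [ym12 ym21] := incomparable _ _ _ _ (comparable_sym xy) m12 m21.
have cancel_l w k n m : w <> 1%g -> add_le w (k * n)%g (k * m)%g -> add_le w n m.
  by move=> w1 /(@add_le_mul2l w k^-1%g _ _ w1); rewrite !mulKg.
have cancel_r w k n m : w <> 1%g -> add_le w (n * k)%g (m * k)%g -> add_le w n m.
  by move=> w1 /(@add_le_mul2r w k^-1%g _ _ w1); rewrite !mulgK.
(* For y, n1 m1 and n2 m2 are incomparable; for x, they would then be equivalent,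
   like n1 m1 and n2 m1, unlike n2 m1 and n2 m2. *)
have y1' : ~ add_le y (n1 * m1)%g (n2 * m2)%g.
  move=> nm; apply: n12; apply: (@cancel_r _ m1 _ _ y1).
  exact/(add_le_trans nm)/add_le_mul2l.
have y2' : ~ add_le y (n2 * m2)%g (n1 * m1)%g.
  move=> nm; apply: n21; apply: (@cancel_r _ m1 _ _ y1).
  by apply: add_le_trans nm; apply/add_le_mul2l.
have [xx _] := incomparable _ _ _ _ xy y1' y2'.
case: m12; apply: (@cancel_l _ n2 _ _ x1).
by apply: add_le_trans xx; apply: add_le_mul2r.
Qed.

Section Level.
Variables (x y : L).
Hypotheses (x1 : x <> 1%g) (y1 : y <> 1%g) (far_xy : far3 x y).
Hypothesis cVxy : comparable_cosets O x^-1%g y.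
Hypothesis le_total : forall n m, add_le y n m \/ add_le y m n.
Hypothesis unit_surj : forall u, exists2 a, vunit O a & psi a = u.

Let le := add_le y.

Lemma add_le_order : group_order le.
Proof.
split=> //; first by move=> b a c; apply: add_le_trans.
  by move=> k n m; apply: add_le_mul2l.
by move=> k n m; apply: add_le_mul2r.
Qed.
Let leG := add_le_order.

Lemma addker_exists a : vunit O a -> exists n, addker a n.
Proof.
move=> ua; have [n [un pn uan pan]] := unit_difference unit_surj ua.
by exists (to_ker O n); rewrite /addker to_kerE.
Qed.

Lemma addker_inv a n : vunit O a -> psi a <> 1%g ->
  addker a^-1 n^-1%g -> psi (a + n%:D) = psi a.
Proof.
move=> ua pa an; have a0 := u0 ua.
have E : a + n%:D = n%:D * (a^-1 + n^-1%g%:D) * a.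
  rewrite kerVE mulrDr mulrDl div_mulrV ?ker_neq0 // mul1r.
  by rewrite div_mulrVK // addrC.
have uVa : vunit O a^-1 by apply: vunitV.
have pVa : psi a^-1 <> 1%g by rewrite psiV // => /eqP; rewrite invg_eq1 => /eqP.
have V0 := u0 (vunit_addker n^-1%g uVa pVa).
by rewrite E psiM ?divE ?V0 ?ker_neq0 // psiM ?ker_neq0 // ker_psi an !mul1g.
Qed.

(** N(b) is neither empty nor equal to N, as N(b^-1) is not empty. *)
Lemma add_le_gt1 : exists n, ~ le n 1%g.
Proof.
have [b ub pb] := unit_surj y.
have [p bp] := addker_exists ub.
have [q bq] := addker_exists (vunitV ub).
have bq' : ~ addker b q^-1%g.
  by rewrite /addker addker_inv ?pb ?invgK.
exists (p^-1 * q^-1)%g => le1; apply: bq'.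
apply: (go_lI leG (c := p^-1%g) _) bp => //.
by rewrite mulVg.
Qed.

Definition ker_m1 : ker_unit O := to_ker O (-1).
Lemma ker_m1E : ker_m1%:D = -1.
Proof.
by apply: to_kerE; [apply/vunitN/vunit1 | rewrite psiN ?psi1 ?oner_neq0].
Qed.

Lemma ker_m1_le : le 1%g ker_m1 /\ le ker_m1 1%g.
Proof.
have m11 : (ker_m1 * ker_m1)%g = 1%g.
  by apply: ker_inj; rewrite kerME ker_m1E mulrNN mulr1.
by have [] := go_sq1 leG m11.
Qed.

Lemma ker_m1_mull n : le n (ker_m1 * n)%g /\ le (ker_m1 * n)%g n.
Proof.
have [m1 m1'] := ker_m1_le; split.
  by have := go_mul2r leG n m1; rewrite mul1g.
by have := go_mul2r leG n m1'; rewrite mul1g.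
Qed.

(** Let a be in the coset of x, with 1 in N(a) and n^-1 in N(a^-1); the latter holds
    for n large, because the coset of x^-1 is comparable with that of y.  Then a + n
    has the image x of a, and 1 - n = (1 + a) - (a + n) shows that the image of 1 - n
    commutes with x.  If b is in the coset of y, with 1 but not n in N(b), then
    1 - n = (1 + b) - (b + n) completes a path from x to y through the images of
    1 - n and b + n. *)
Lemma level_sub : exists2 th, le 1%g th & forall n, ~ le n th ->
  vunit O (1 - n%:D) /\ psi (1 - n%:D) = 1%g.
Proof.
have [a0 ua0 pa0] := unit_surj x.
have [p a0p] := addker_exists ua0.
have [r a0r] := addker_exists (vunitV ua0).
have pa0' : psi a0 <> 1%g by rewrite pa0.
have pVa0 : psi a0^-1 <> 1%g.
  by rewrite psiV ?(u0 ua0) // pa0 => /eqP; rewrite invg_eq1 => /eqP.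
pose a := p^-1%g%:D * a0.
have ua : vunit O a by apply: vunitM => //; apply: ker_vunit.
have pa : psi a = x by rewrite psiM ?ker_neq0 ?(u0 ua0) // ker_psi mul1g.
have a1 : addker a (p^-1 * p)%g by apply/addker_mull.
rewrite mulVg in a1.
have aV : addker a^-1 (r * p)%g.
  rewrite /a div_invM ?ker_neq0 ?(u0 ua0) // kerVE invrK.
  by apply/addker_mulr => //; apply: vunitV.
clearbody a.
have pVa : psi a^-1 = x^-1%g by rewrite psiV ?(u0 ua) // pa.
have H n : ~ le n 1%g -> ~ le n (r * p)^-1%g ->
    vunit O (1 - n%:D) /\ psi (1 - n%:D) = 1%g.
  move=> n1 nrp.
  have an : addker a^-1 n^-1%g.
    apply: contrapT => nan; apply: nrp; rewrite -[n]invgK; apply: (go_inv leG).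
    by apply: (comparable_add_le cVxy); exists a^-1; split=> //; apply: vunitV.
  have pan : psi (a + n%:D) = x by rewrite addker_inv ?pa.
  have [b [ub pb b1 bn]] := not_add_le n1.
  have E c : 1 - n%:D = (c + 1) + - (c + n%:D).
    by rewrite opprD addrACA subrr add0r.
  have comm c : vunit O c -> psi c <> 1%g -> addker c (1%g : ker_unit O) -> psi (c + n%:D) <> 1%g ->
      commute (psi (c + n%:D)) (psi (1 - n%:D)).
    move=> uc pc c1 cn; rewrite (E c).
    have ucn := vunit_addker n uc pc.
    have uN := vunitN ucn.
    have pN : psi (- (c + n%:D)) = psi (c + n%:D) by rewrite psiN ?(u0 ucn).
    have uc1 : vunit O (c + 1) by apply: (vunit_addker 1%g).
    by have := vunit_add_commute uc1 uN c1; rewrite pN; apply.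
  have c1 := comm a ua _ a1; rewrite pa pan in c1.
  have c2 := comm b ub _ b1 bn; rewrite pb in c2.
  have c3 : commute y (psi (b + n%:D)).
    by rewrite -pb; apply: addker_commute; rewrite ?pb.
  split; last by case: (far_xy (c1 x1 x1) (commute_sym (c2 y1)) (commute_sym c3)).
  have uan : vunit O (a + n%:D) by apply: vunit_addker; rewrite ?pa.
  have ua1 : vunit O (a + 1) by apply: (vunit_addker 1%g); rewrite ?pa.
  rewrite (E a); apply: vunit_add => //; first exact: vunitN.
  by rewrite psiN ?(u0 uan) // pan a1 => /esym.
case: (le_total 1%g (r * p)^-1%g) => rp.
  exists (r * p)^-1%g => // n nrp; apply: H => // n1; apply: nrp.
  exact: (go_trans leG n1 rp).
exists 1%g; first exact: go_refl.
move=> n n1; apply: H => // nrp; apply: n1.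
exact: (go_trans leG nrp rp).
Qed.

Lemma level_add : exists2 th, le 1%g th &
  forall n, ~ le n th -> psi (1 - n%:D) = 1%g /\
    vunit O (1 + n%:D) /\ psi (1 + n%:D) = 1%g.
Proof.
have [th th1 H] := level_sub; exists th => // n nth; split; first by case: (H n nth).
have := H (ker_m1 * n)%g; rewrite kerME ker_m1E mulN1r opprK; apply=> mn.
by apply: nth; apply: (go_trans leG (ker_m1_mull n).1 mn).
Qed.

(** If 1 < p, choose b such that 1 is in N(b) but n and p are not.  Then q = b + 1 is in
    N and q + n = b + p is not, so that n is at most q * th, whence th < q; but then
    b = q - 1 would have a trivial image. *)
Lemma level_le1 th n p : le 1%g th ->
  (forall n, ~ le n th -> psi (1 - n%:D) = 1%g /\
    vunit O (1 + n%:D) /\ psi (1 + n%:D) = 1%g) ->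
  ~ le n (th * th)%g -> 1 + n%:D = p%:D -> le p 1%g.
Proof.
move=> th1 th_add nth np; apply: contrapT => p1.
have n1 : ~ le n 1%g.
  move=> n1; apply: nth; apply: (go_trans leG n1 _).
  by rewrite -[1%g]mulg1; apply: (go_mul leG).
have [b [ub pb b1 bn bp]] : exists b,
    [/\ vunit O b, psi b = y, addker b (1%g : ker_unit O), ~ addker b n & ~ addker b p].
  case: (le_total n p) => np'.
    have [b [ub pb b1 bn]] := not_add_le n1.
    by exists b; split=> // /(np' b ub pb).
  have [b [ub pb b1 bp]] := not_add_le p1.
  by exists b; split=> // /(np' b ub pb).
have pb1 : psi b <> 1%g by rewrite pb.
pose q := to_ker O (b + 1).
have qE : q%:D = b + 1 by apply: to_kerE => //; apply: (vunit_addker 1%g).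
clearbody q.
have nq : le n (q * th)%g.
  apply: contrapT => nq; apply: bp.
  have [|_ [_]] := th_add (q^-1 * n)%g.
    by move/(go_mul2l leG q); rewrite mulVKg.
  rewrite kerME kerVE => H; rewrite /addker -np addrA -qE.
  have E : q%:D + n%:D = q%:D * (1 + q%:D^-1 * n%:D).
    by rewrite mulrDr mulr1 div_mulVKr ?ker_neq0.
  rewrite E psiM ?ker_psi ?mul1g ?ker_neq0 //.
  have : vunit O (b + p%:D) by apply: vunit_addker.
  by rewrite -np addrA -qE E => /u0; rewrite !divE => /andP[].
have nqth : ~ le q th.
  move=> qth; apply: nth; apply: (go_trans leG nq _).
  exact: (go_mul2r leG).
have [H _] := th_add q nqth; apply: pb1.
by rewrite -H qE opprD addrCA subrr addr0 psiN ?(u0 ub).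
Qed.

Lemma level : exists2 om, le 1%g om & forall n, ~ le n om ->
  exists m, [/\ 1 + n%:D = m%:D, le m 1%g & le 1%g m].
Proof.
have [th th1 th_add] := level_add; exists (th * th)%g.
  by rewrite -[1%g]mulg1; apply: (go_mul leG).
move=> n nth.
have nth' : ~ le n th.
  move=> nth'; apply: nth; rewrite -[n]mulg1; exact: (go_mul leG).
have [_ [un pn]] := th_add n nth'.
exists (to_ker O (1 + n%:D)); rewrite to_kerE //.
set p := to_ker O _; have pE : 1 + n%:D = p%:D by rewrite to_kerE.
split=> //; first exact: (level_le1 th1 th_add nth).
(* If p < 1, then s := - n / p satisfies s >= n and 1 + s = p^-1 > 1. *)
apply: contrapT => p1; pose s := (ker_m1 * (p^-1 * n))%g.
have p1' : le p 1%g by case: (go_total leG p 1%g).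
have sE : 1 + s%:D = (p^-1)%g%:D.
  rewrite !kerME ker_m1E mulN1r kerVE -{1}(div_mulVr divD (ker_neq0 p)) -mulrBr -pE.
  by rewrite addrK mulr1.
have ns : le n s.
  apply: (go_trans leG _ (ker_m1_mull _).1).
  rewrite -{1}[n]mul1g; apply: (go_mul2r leG).
  by rewrite -invg1; apply: (go_inv leG).
apply: p1; rewrite -[p]invgK -invg1; apply: (go_inv leG).
apply: (level_le1 th1 th_add _ sE) => sth; apply: nth.
exact: (go_trans leG ns sth).
Qed.

Lemma add_le_max h n m : vmax O h -> n%:D + h = m%:D -> le n m.
Proof.
move=> mh nm b ub pb; rewrite /addker -nm => bm.
have ubn : vunit O (b + n%:D) by apply: vunit_addker; rewrite ?pb.
by have := psi_addm ubn mh; rewrite -addrA bm => ->.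
Qed.

Lemma add_le_conj g n m : g != 0 -> psi g = 1%g -> le n m ->
  le (conj_ker g n) (conj_ker g m).
Proof.
move=> g0 pg nm b ub pb.
have Vg0 : g^-1 != 0 by rewrite !divE.
pose b' := g^-1^-1 * b * g^-1.
have ub' : vunit O b' by apply: vunitJ.
have pb' : psi b' = y.
  by rewrite /b' !psiM ?divE ?g0 ?(u0 ub) // invrK psiV // pg pb mul1g invg1 mulg1.
have E k : addker b (conj_ker g k) <-> addker b' k.
  have Ek : b' + k%:D = g * (b + (conj_ker g k)%:D) * g^-1.
    by rewrite conj_kerE // mulrDr mulrDl /b' invrK !mulrA div_mulrV // mul1r div_mulrK.
  have V0 : b + (conj_ker g k)%:D != 0.
    by apply/u0/vunit_addker; rewrite ?pb.
  by rewrite /addker Ek !psiM ?divE ?g0 ?V0 // psiV // pg mul1g invg1 mulg1.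
by move=> /E/(nm b' ub' pb')/E.
Qed.

Lemma add_le_leveled : leveled_order le.
Proof.
split; [exact: add_le_order | exact: add_le_gt1 | exact: level | exact: add_le_max
  | exact: add_le_conj].
Qed.

End Level.

Lemma exists_leveled_order x y : x <> 1%g -> y <> 1%g -> compatible_pair x y ->
  (forall u, exists2 a, vunit O a & psi a = u) -> exists le, leveled_order le.
Proof.
move=> x1 y1 xy surj.
have Vneq1 (u : L) : u <> 1%g -> (u^-1 <> 1)%g.
  by move=> u1 /eqP; rewrite invg_eq1 => /eqP.
have [far_xy [cxy cVxy cVyx]] : far3 x y /\ [/\ comparable_cosets O x y,
    comparable_cosets O x^-1%g y & comparable_cosets O y^-1%g x].
  case: xy => [xy|[xy y_xy y_Vxy x_Vyx]]; split=> //; first exact: far4_far3.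
    split; apply: far4_comparable => //; try exact: Vneq1; first exact: far4V.
    exact/far4V/far4_sym.
  by split; apply: far3_comparable => //; try exact: Vneq1; apply: far3V => //; apply: far3_sym.
case: (add_le_total x1 y1 cxy) => tot.
  exists (add_le x).
  exact: (add_le_leveled y1 x1 (far3_sym far_xy) cVyx tot surj).
exists (add_le y); exact: (add_le_leveled x1 y1 far_xy cVxy tot surj).
Qed.

End LeveledOrder.

(** * Small elements and central elements *)

Definition central (D : unitRingType) (c : D) := forall x : D, c * x = x * c.

Lemma centralM (D : unitRingType) (c c' : D) :
  central c -> central c' -> central (c * c').
Proof. by move=> cC cC' x; rewrite -mulrA cC' mulrA cC mulrA. Qed.

Lemma centralV (D : unitRingType) (c : D) :
  division_ring D -> central c -> central c^-1.
Proof.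
move=> divD cC x; have [->|c0] := eqVneq c 0; first by rewrite invr0 mul0r mulr0.
by rewrite -{1}(div_mulrK divD x c0) -cC -mulrA div_mulKr.
Qed.

Definition algebraic_over_center (D : unitRingType) := forall x : D,
  exists p : {poly D}, [/\ p != 0, forall i, central p`_i & p.[x] = 0].

Lemma simple_der1 (D : unitRingType) (L : finGroupType) (psi : division_quotient D L) :
  [~: [set: L], [set: L]]%g = [set: L].
Proof.
have [_ simL] := simpleP _ (dq_simple psi).
case: (simL _ (der_normal 1 [set: L])) => //.
by move/commG1P => ab; case/negP: (dq_nonabelian psi).
Qed.

Section Small.
Variables (D : unitRingType) (L : finGroupType) (psi : division_quotient D L).
Variable O : compatible_ring psi.
Implicit Types (r s x : D) (n m u v w : ker_unit O).

Let divD := dq_div psi.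
Let divE := divE divD.
Let psiM := @dq_mul D L psi.
Let u0 := @vunit_neq0 D O.

Hypothesis unit_surj : forall t, exists2 a, vunit O a & psi a = t.
Hypothesis alg : algebraic_over_center D.

Variable le : ker_unit O -> ker_unit O -> Prop.
Hypothesis lo : leveled_order le.
Let leG := lo_order lo.
Let letr := go_trans leG.

Variable om : ker_unit O.
Hypotheses (om1 : le 1%g om) (om_level : forall n, ~ le n om ->
    exists m, [/\ 1 + n%:D = m%:D, le m 1%g & le 1%g m]).

Definition neutral u := le u 1%g /\ le 1%g u.

Lemma neutral1 : neutral 1%g. Proof. by split; apply: go_refl leG _. Qed.

Lemma neutralM u v : neutral u -> neutral v -> neutral (u * v)%g.
Proof. by move=> [? ?] [? ?]; split; rewrite -[1%g]mulg1; apply: (go_mul leG). Qed.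

Lemma neutralV u : neutral u -> neutral u^-1%g.
Proof. by move=> [? ?]; split; rewrite -invg1; apply: (go_inv leG). Qed.

Lemma neutral_m1 : neutral (ker_m1 O).
Proof.
apply: (go_sq1 leG); apply: ker_inj.
by rewrite kerME ker_m1E mulrNN mulr1.
Qed.

(** The additive group of the elements that preserve the class of 1; it plays the role
    of the maximal ideal of a valuation. *)
Definition small r := forall u, neutral u -> exists2 v, neutral v & r + u%:D = v%:D.

Lemma small0 : small 0.
Proof. by move=> u nu; exists u; rewrite ?add0r. Qed.

Lemma smallN r : small r -> small (- r).
Proof.
move=> sr u nu; have [v nv E] := sr _ (neutralM neutral_m1 nu).
exists (ker_m1 O * v)%g; first exact: neutralM neutral_m1 nv.
by rewrite kerME -E kerME ker_m1E !mulN1r opprD opprK.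
Qed.

Lemma smallD r s : small r -> small s -> small (r + s).
Proof.
move=> sr ss u nu; have [v nv E] := ss u nu; have [w nw E'] := sr v nv.
by exists w; rewrite // -addrA E.
Qed.

Lemma small_muln r k : small r -> small (r *+ k).
Proof.
move=> sr; elim: k => [|k IH]; first by rewrite mulr0n; apply: small0.
by rewrite mulrS; apply: smallD.
Qed.

Lemma small_sum (I : Type) (s : seq I) (P : pred I) (F : I -> D) :
  (forall i, P i -> small (F i)) -> small (\sum_(i <- s | P i) F i).
Proof. by move=> sF; elim/big_ind: _ => //; [apply: small0 | apply: smallD]. Qed.

Lemma small_mulr r u : small r -> neutral u -> small (r * u%:D).
Proof.
move=> sr nu v nv; have [w nw E] := sr _ (neutralM nv (neutralV nu)).
exists (w * u)%g; first exact: neutralM.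
by rewrite kerME -E kerME kerVE mulrDl div_mulrVK ?ker_neq0.
Qed.

(** Remove from (r + 1) * (s + u) the small terms s and r * u. *)
Lemma smallM r s : small r -> small s -> small (r * s).
Proof.
move=> sr ss u nu.
have [v1 n1 E1] := sr _ neutral1.
have [v2 n2 E2] := ss u nu.
have [v3 n3 E3] := smallN ss (neutralM n1 n2).
have [v4 n4 E4] := smallN (small_mulr sr nu) n3.
exists v4 => //; rewrite -E4 -E3 kerME -E1 -E2 ker1E.
rewrite mulrDl mul1r mulrDr [in RHS](addrC (r * s)) -addrA (addrCA (r * s)).
by rewrite (addrCA (r * u%:D)) !addKr.
Qed.

Lemma small_exp r k : small r -> small (r ^+ k.+1).
Proof. by move=> sr; elim: k => [|k IH] //; rewrite exprS; apply: smallM. Qed.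

Lemma small_not1 : ~ small 1.
Proof.
move=> /(_ _ neutral_m1)[v _]; rewrite ker_m1E subrr => /esym/eqP.
by rewrite (negbTE (ker_neq0 v)).
Qed.

Lemma small_add1 r : small r -> psi (1 + r) = 1%g.
Proof. by move=> /(_ _ neutral1)[v _]; rewrite ker1E addrC => ->; apply: ker_psi. Qed.

Lemma small_max h : vmax O h -> small h.
Proof.
move=> mh u [u1 u1']; have uu : vunit O (u%:D + h) := vunitDm (ker_vunit u) mh.
have puh : psi (u%:D + h) = 1%g by rewrite (psi_addm (ker_vunit u) mh) ker_psi.
exists (to_ker O (u%:D + h)); last by rewrite to_kerE // addrC.
split.
  by apply: letr u1; apply: (lo_max lo (h := - h)); rewrite ?to_kerE ?addrK //; apply: vmaxN.
by apply: letr u1' _; apply: (lo_max lo mh); rewrite to_kerE.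
Qed.

Lemma small_large n : ~ le n om -> small n%:D.
Proof.
move=> nom u nu; have [|m [mE m1 m1']] := @om_level (u^-1 * n)%g.
  move=> un; apply: nom; apply: letr un; rewrite -{1}[n]mul1g.
  by apply: (go_mul2r leG); case: (neutralV nu).
exists (u * m)%g; first exact: neutralM.
by rewrite kerME -mE kerME kerVE mulrDr mulr1 div_mulVKr ?ker_neq0 // addrC.
Qed.

Lemma small_ge n : small n%:D -> le om^-1%g n.
Proof.
move=> sn; apply: contrapT => nom.
have [|m [mE m1 m1']] := @om_level n^-1%g.
  by move/(go_inv leG); rewrite invgK.
have [v nv E] := sn _ neutral1; apply: nom.
have -> : n = (v * m^-1)%g.
  apply: (mulIg m); rewrite mulgVK; apply: ker_inj.
  by rewrite kerME -mE -E kerVE mulrDr mulr1 div_mulrV ?ker_neq0.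
have [_ v1] := neutralM nv (neutralV (conj m1 m1')).
by apply: letr v1; rewrite -invg1; apply: (go_inv leG).
Qed.

(** Every unit is a difference of two elements of N, for which this is clear. *)
Lemma small_bound r : O r -> exists d, forall m, le d m -> small (m%:D * r) /\ small (r * m%:D).
Proof.
move=> Or; have [mr|mr] := pselect (vmax O r).
  exists 1%g => m _; split; apply: small_max; [apply: vmaxMl | apply: vmaxMr] => //;
    exact/vunit_O/ker_vunit.
have [n [un pn urn prn]] := unit_difference unit_surj (vunitP Or mr).
pose n1 := to_ker O (r + n); pose n2 := to_ker O n.
have rE : r = n1%:D - n2%:D by rewrite !to_kerE // addrK.
have [t t1] := lo_gt1 lo.
have tom k : le (t * om)%g k -> small k%:D.
  move=> tk; apply: small_large => kom; apply: t1; apply: (@go_rI _ _ leG om).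
  by rewrite mul1g; apply: letr tk kom.
have [d dP] := go_upper_bound leG [:: t * om * n1^-1; t * om * n2^-1; n1^-1 * (t * om); n2^-1 * (t * om)]%g.
have {}dP m a : le d m -> a \in [:: t * om * n1^-1; t * om * n2^-1; n1^-1 * (t * om); n2^-1 * (t * om)]%g -> le a m.
  by move=> dm /dP ad; apply: letr ad dm.
exists d => m dm; rewrite rE mulrBr mulrBl; split; apply/smallD/smallN; rewrite -kerME; apply: tom.
- by have := go_mul2r leG n1 (dP m (t * om * n1^-1)%g dm _); rewrite mulgVK; apply; rewrite !inE eqxx.
- by have := go_mul2r leG n2 (dP m (t * om * n2^-1)%g dm _); rewrite mulgVK; apply; rewrite !inE eqxx ?orbT.
- by have := go_mul2l leG n1 (dP m (n1^-1 * (t * om))%g dm _); rewrite mulVKg; apply; rewrite !inE eqxx ?orbT.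
- by have := go_mul2l leG n2 (dP m (n2^-1 * (t * om))%g dm _); rewrite mulVKg; apply; rewrite !inE eqxx ?orbT.
Qed.

Definition kcentral w := central w%:D.

Lemma kcentral_comm w n : kcentral w -> commute w n.
Proof. by move=> wC; apply: ker_inj; rewrite !kerME wC. Qed.

Lemma central_psi (c : D) : c != 0 -> central c -> psi c = 1%g.
Proof. exact: psi_central. Qed.

(** The exponent d and the central element w come from the equation of r over the center:
    two of its terms have the same value, up to om. *)
Lemma central_tie (r : ker_unit O) : exists d w, [/\ (0 < d)%N, kcentral w,
  le (w * om^-1)%g (r ^+ d)%g & le (r ^+ d)%g (w * om)%g].
Proof.
have [p [p0 pC pr]] := alg r%:D.
(* Divide the equation by a coefficient of smallest value: all coefficients are then
   in O, and those of smallest value are units. *)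
pose nz := [seq i <- iota 0 (size p) | p`_i != 0].
have [i0 i0nz i0min] : exists2 i, i \in nz & forall j, j \in nz -> O (p`_j / p`_i).
  have nzP i : i \in nz -> p`_i != 0 by rewrite mem_filter => /andP[].
  apply: (@seq_minimum _ (fun i j => O (p`_j / p`_i))).
  - move=> i j /nzP pi /nzP pj.
    have pji : p`_j / p`_i != 0 by rewrite !divE pj pi.
    by case: (vrV O pji) => H; [left | right]; rewrite // div_invM ?divE // invrK in H.
  - move=> j i k /nzP pi /nzP pj /nzP pk ij jk.
    by have := vrM jk ij; rewrite mulrA div_mulrVK.
  - apply/eqP => nz0; have : (size p).-1 \in nz.
      rewrite mem_filter -/(lead_coef p) lead_coef_eq0 p0 mem_iota add0n /=.
      by rewrite prednK // size_poly_gt0.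
    by rewrite nz0.
have pi0 : p`_i0 != 0 by move: i0nz; rewrite mem_filter => /andP[].
pose c i := p`_i / p`_i0.
have cC i : central (c i) by apply/centralM/centralV.
have c0 i : (c i == 0) = (p`_i == 0) by rewrite !divE (negbTE pi0) orbF.
have sum0 : \sum_(i < size p) c i * r%:D ^+ i = 0.
  have E : (p`_i0)^-1 * p.[r%:D] = 0 by rewrite pr mulr0.
  rewrite horner_coef big_distrr /= in E; apply: etrans E.
  by apply: eq_bigr => i _; rewrite mulrA /c [(p`_i0)^-1 * _](centralV divD (pC i0)).
have cO i : O (c i).
  have [ci|ci] := eqVneq (c i) 0; first by rewrite ci; apply: vr0.
  apply: i0min; rewrite mem_filter -c0 ci mem_iota add0n /=.
  by rewrite ltnNge; apply: contra ci => pi; rewrite c0 nth_default.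
have ci0 : c i0 = 1 by rewrite /c div_mulrV.
have i0sz : (i0 < size p)%N by move: i0nz; rewrite mem_filter mem_iota => /andP[].
clearbody c; set N := size p in sum0 i0sz.
pose S := [seq i <- iota 0 N | `[< vunit O (c i) >]].
have SP i : i \in S -> vunit O (c i) /\ (i < N)%N.
  by rewrite mem_filter mem_iota => /andP[/asboolP ? /andP[_ ?]].
pose C i := to_ker O (c i); pose t i := (C i * r ^+ i)%g.
have CE i : i \in S -> (C i)%:D = c i.
  by move=> /SP[ui _]; apply: to_kerE => //; apply: central_psi => //; apply: u0.
have tE i : i \in S -> (t i)%:D = c i * r%:D ^+ i by move=> /CE Ci; rewrite kerME Ci kerXE.
have [i1 i1S i1min] : exists2 i, i \in S & forall j, j \in S -> le (t i) (t j).
  apply: (@seq_minimum _ (fun i j => le (t i) (t j))).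
  - by move=> i j _ _; apply: (go_total leG).
  - by move=> j i k _ _ _; apply: letr.
  - apply/eqP => S0; have : i0 \in S; last by rewrite S0.
    rewrite mem_filter mem_iota i0sz ci0 !andbT; apply/asboolP; exact: vunit1.
(* In a vanishing sum the minimal term cannot be far below all the others. *)
have [j [jS ji1 jt]] : exists j, [/\ j \in S, j != i1 & le (t j) (t i1 * om)%g].
  apply: contrapT => nj; apply: small_not1; have [_ i1N] := SP i1 i1S.
  have T0 := ker_neq0 (t i1); set T := (t i1)%:D in T0.
  have -> : 1 = - \sum_(i < N | i != Ordinal i1N) T^-1 * (c i * r%:D ^+ i).
    apply/eqP; rewrite -addr_eq0 -big_distrr /= -(div_mulVr divD T0) -mulrDr.
    have := sum0; rewrite (bigD1 (Ordinal i1N)) //= /T tE // => ->.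
    by rewrite mulr0.
  apply/smallN/small_sum => i ii1.
  have [ui|ui] := pselect (vunit O (c i)); last first.
    apply/small_max/vmaxMl; first by apply/vunit_O/vunitV/ker_vunit.
    apply: vmaxMr; last by apply/vrX/vunit_O/ker_vunit.
    by apply: contrapT => mi; apply: ui; apply: vunitP.
  have iS : (i : nat) \in S by rewrite mem_filter mem_iota ltn_ord !andbT; apply/asboolP.
  rewrite -tE // /T -kerVE -kerME; apply: small_large => H.
  apply: nj; exists (i : nat); split=> //.
  by have := go_mul2l leG (t i1) H; rewrite mulVKg.
have Ccomm i n : i \in S -> commute (C i) n.
  by move=> iS; apply: kcentral_comm; rewrite /kcentral CE.
have comm_C i n : i \in S -> (n * C i = C i * n)%g by move=> iS; rewrite Ccomm.
have CVc i j' : i \in S -> j' \in S -> kcentral ((C i)^-1 * C j')%g.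
  by move=> iS jS'; rewrite /kcentral kerME kerVE !CE //; apply/centralM => //; apply/centralV.
have om1' : le om^-1%g 1%g by rewrite -[1%g]invg1; apply: (go_inv leG).
have jt' := i1min j jS; rewrite /t in jt jt'.
case: (ltngtP i1 j) ji1 => // ij _.
  exists (j - i1)%N, ((C j)^-1 * C i1)%g; rewrite subn_gt0 ij.
  have Ej : (r ^+ j = r ^+ i1 * r ^+ (j - i1))%g by rewrite -expgnDr subnKC // ltnW.
  have up : le (r ^+ (j - i1))%g ((C j)^-1 * C i1 * om)%g.
    apply: (go_lI leG (c := C j)); rewrite !mulgA mulgV mul1g.
    apply: (go_lI leG (c := (r ^+ i1)%g)).
    by rewrite !mulgA !comm_C // -!mulgA -Ej [X in le _ X]mulgA.
  split=> //; first exact: CVc.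
  apply: (letr _ (b := ((C j)^-1 * C i1 * 1)%g)); first exact: (go_mul2l leG).
  rewrite mulg1; apply: (go_lI leG (c := C j)); rewrite mulVKg.
  apply: (go_lI leG (c := (r ^+ i1)%g)).
  by rewrite comm_C // mulgA comm_C // -mulgA -Ej.
exists (i1 - j)%N, ((C i1)^-1 * C j)%g; rewrite subn_gt0 ij.
have Ei : (r ^+ i1 = r ^+ j * r ^+ (i1 - j))%g by rewrite -expgnDr subnKC // ltnW.
split=> //; first exact: CVc.
  apply: (go_rI leG (c := om)); rewrite mulgVK.
  apply: (go_lI leG (c := C i1)); rewrite mulVKg.
  apply: (go_lI leG (c := (r ^+ j)%g)).
  by rewrite comm_C // !mulgA comm_C // -[X in le _ (X * om)%g]mulgA -Ei.
apply: (letr (b := ((C i1)^-1 * C j * 1)%g)); last exact: (go_mul2l leG).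
rewrite mulg1; apply: (go_lI leG (c := C i1)); rewrite mulVKg.
apply: (go_lI leG (c := (r ^+ j)%g)).
by rewrite comm_C // mulgA comm_C // -mulgA -Ei.
Qed.

Lemma central_above (s : seq (ker_unit O)) :
  exists2 w, kcentral w & forall a, a \in s -> le a w.
Proof.
have [b bP] := go_upper_bound leG (1%g :: [seq (a * om)%g | a <- s]).
have b1 : le 1%g b by apply: bP; rewrite mem_head.
have [d [w [d0 wC _ bw]]] := central_tie b.
exists w => // a sa; apply: (go_rI leG (c := om)).
apply: letr bw; apply: (letr (b := b)); first by apply: bP; rewrite inE; apply/orP; right; apply/mapP; exists a.
by have := go_exp_mono leG b1 d0; rewrite expg1.
Qed.

Lemma kcentralM v w : kcentral v -> kcentral w -> kcentral (v * w)%g.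
Proof. by rewrite /kcentral kerME; apply: centralM. Qed.

Lemma kcentralV w : kcentral w -> kcentral w^-1%g.
Proof. by rewrite /kcentral kerVE; apply: centralV. Qed.

Lemma kcentralX w k : kcentral w -> kcentral (w ^+ k)%g.
Proof.
move=> wC; elim: k => [|k IH]; last by rewrite expgS; apply: kcentralM.
by move=> x; rewrite expg0 ker1E mul1r mulr1.
Qed.

Lemma conj_kerM g n m : g != 0 -> conj_ker g (n * m)%g = (conj_ker g n * conj_ker g m)%g.
Proof.
move=> g0; apply: ker_inj; rewrite kerME !conj_kerE // kerME.
by rewrite !mulrA div_mulrK.
Qed.

Lemma conj_ker_central g w : g != 0 -> kcentral w -> conj_ker g w = w.
Proof.
by move=> g0 wC; apply: ker_inj; rewrite conj_kerE // -wC div_mulrVK.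
Qed.

Lemma conj_kerX g n k : g != 0 -> conj_ker g (n ^+ k)%g = (conj_ker g n ^+ k)%g.
Proof.
move=> g0; elim: k => [|k IH]; last by rewrite !expgS conj_kerM // IH.
by apply: conj_ker_central => // x; rewrite mul1r mulr1.
Qed.

Lemma conj_kerV g n : g != 0 -> conj_ker g n^-1%g = (conj_ker g n)^-1%g.
Proof.
move=> g0; apply: (mulgI (conj_ker g n)); rewrite -conj_kerM // !mulgV.
by apply: conj_ker_central => // x; rewrite mul1r mulr1.
Qed.

Lemma conj_ker_comp g h n : g != 0 -> h != 0 ->
  conj_ker h (conj_ker g n) = conj_ker (g * h) n.
Proof.
move=> g0 h0; apply: ker_inj; rewrite !conj_kerE ?divE ?g0 // div_invM //.
by rewrite !mulrA.
Qed.

Lemma conj_ker_ker n m : conj_ker n%:D m = (m ^ n)%g.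
Proof.
apply: ker_inj; rewrite conj_kerE ?ker_neq0 // conjgE !kerME kerVE.
by rewrite mulrA.
Qed.

(** * Refinement of the valuation ring *)

Section Scale.
(** The scale z exceeds om and the size of the chosen representatives of L and of their
    inverses. *)
Variables (z : ker_unit O) (sec : L -> D).
Hypotheses (zC : kcentral z) (z_om : ~ le z om).
Hypotheses (sec_unit : forall t, vunit O (sec t)) (psi_sec : forall t, psi (sec t) = t).
Hypothesis z_sec : forall t m, le z m ->
  [/\ small (m%:D * sec t), small (sec t * m%:D)
    , small (m%:D * (sec t)^-1) & small ((sec t)^-1 * m%:D)].

Let zcomm a : commute z a. Proof. exact: kcentral_comm. Qed.
Let om_z : le om z. Proof. by case: (go_total leG om z). Qed.
Let z1 : le 1%g z. Proof. exact: letr om1 om_z. Qed.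
Let nz1 : ~ le z 1%g. Proof. by move=> z1'; apply: z_om; apply: letr z1' om1. Qed.
Let sec0 t : sec t != 0. Proof. exact: u0. Qed.

Lemma small_scale m : le z m -> small m%:D.
Proof. by move=> zm; apply: small_large => mom; apply: z_om; apply: letr zm mom. Qed.

Lemma small_ge_z n : small n%:D -> le z^-1%g n.
Proof. by move/small_ge; apply: letr; apply: (go_inv leG). Qed.

(** z^2 s^-1 n s = (s^-1 z) (z n s) is a product of two small elements. *)
Lemma conj_sec_ge t n : le 1%g n -> le (z ^- 3)%g (conj_ker (sec t) n).
Proof.
move=> n1; have [_ _ _ s1] := z_sec t (go_refl leG z).
have zn : le z (z * n)%g by rewrite -{1}[z]mulg1; apply: (go_mul2l leG).
have [s3 _ _ _] := z_sec t zn.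
have /small_ge_z : small (z ^+ 2 * conj_ker (sec t) n)%g%:D.
  rewrite kerME kerXE conj_kerE //.
  have -> : z%:D ^+ 2 * ((sec t)^-1 * n%:D * sec t) = (sec t)^-1 * z%:D * ((z * n)%g%:D * sec t).
    by rewrite kerME expr2 !mulrA; congr (_ * _ * _); rewrite -mulrA zC zC.
  exact: smallM.
move/(go_mul2l leG (z ^- 2)%g); rewrite mulKg; apply: letr.
by rewrite -invgM -expgS; apply: go_refl leG _.
Qed.

(** Conjugation by the kernel of psi preserves the order, and the representatives
    of L only move it by a power of z. *)
Lemma conj_ge g n : g != 0 -> le 1%g n -> le (z ^- 3)%g (conj_ker g n).
Proof.
move=> g0 n1; pose s := sec (psi g); pose m := s^-1 * g.
have m0 : m != 0 by rewrite !divE sec0.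
have pm : psi m = 1%g by rewrite psiM ?divE ?sec0 // psiV ?sec0 // /s psi_sec mulVg.
have -> : conj_ker g n = conj_ker m (conj_ker s n).
  by rewrite conj_ker_comp ?sec0 //; rewrite /m div_mulVKr ?sec0.
have <- : conj_ker m (z ^- 3)%g = (z ^- 3)%g.
  by apply: conj_ker_central => //; apply/kcentralV/kcentralX.
by apply: (lo_conj lo) => //; apply: conj_sec_ge.
Qed.

Lemma expz_le i j : (i <= j)%N -> le (z ^+ i)%g (z ^+ j)%g.
Proof. exact: go_exp_mono. Qed.

Lemma expzV_le i j : (i <= j)%N -> le (z ^- j)%g (z ^- i)%g.
Proof. by move=> ij; apply/(go_inv leG)/expz_le. Qed.

Lemma conj_close g n k : g != 0 -> close_powers le z 4 (conj_ker g n) n k.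
Proof.
move=> g0; have [d [w [d0 wC lo_w w_hi]]] := central_tie (n ^+ k.+1)%g.
rewrite -expgnA in lo_w w_hi; set K := (k.+1 * d)%N in lo_w w_hi.
have kK : (k <= K)%N by rewrite (leq_trans (leqnSn k)) // leq_pmulr.
have wz (j : nat) : kcentral (w * z ^+ j)%g by apply/kcentralM/kcentralX.
have wz' (j : nat) : kcentral (w * z ^- j)%g by apply/kcentralM/kcentralV/kcentralX.
have lo1 : le (w * z ^- 1)%g (n ^+ K)%g.
  by apply: letr lo_w; apply: (go_mul2l leG); apply: (go_inv leG).
have hi1 : le (n ^+ K)%g (w * z ^+ 1)%g.
  by apply: letr w_hi _; apply: (go_mul2l leG).
exists K, w; split=> //.
- by move=> a; apply: kcentral_comm.
- split.
    by apply: letr lo1; apply: (go_mul2l leG); apply: expzV_le.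
  by apply: letr hi1 _; apply: (go_mul2l leG); apply: expz_le.
- split.
    have : le 1%g ((w * z ^- 1)^-1 * n ^+ K)%g.
      by apply: (go_lI leG (c := (w * z ^- 1)%g)); rewrite mulg1 mulVKg.
    move/(conj_ge g0); rewrite conj_kerM // conj_kerX //.
    rewrite (conj_ker_central g0 (kcentralV (wz' 1%N))).
    move/(go_mul2l leG (w * z ^- 1)%g); rewrite mulVKg.
    by rewrite -mulgA -invgM -expgnDr.
  have : le 1%g ((n ^+ K)^-1 * (w * z ^+ 1))%g.
    by apply: (go_lI leG (c := (n ^+ K)%g)); rewrite mulg1 mulVKg.
  move/(conj_ge g0); rewrite conj_kerM // conj_kerV // conj_kerX //.
  rewrite (conj_ker_central g0 (wz 1%N)).
  move/(go_mul2l leG (conj_ker g n ^+ K)%g)/(go_mul2r leG (z ^+ 3)%g).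
  by rewrite mulVKg mulgVK -mulgA -expgnDr.
Qed.

Definition eqv n m := infinitesimal le z (n * m^-1)%g.

(** Arbitrarily large powers of n are central up to om, and conjugation by g fixes the
    central elements while moving the order by a power of z only. *)
Lemma conj_eqv g n : g != 0 -> eqv (conj_ker g n) n.
Proof.
by move=> g0; apply: (close_inf leG zcomm z1 (c := 4)) => k; apply: conj_close.
Qed.

Lemma eqv_refl n : eqv n n.
Proof. by rewrite /eqv mulgV; apply: inf1 leG _. Qed.

Lemma eqv_sym n m : eqv n m -> eqv m n.
Proof. by move/infV; rewrite invgM invgK. Qed.

Lemma eqv_trans m n k : eqv n m -> eqv m k -> eqv n k.
Proof.
move=> nm mk; rewrite /eqv -[n](mulgVK m) -mulgA.
exact: (infM leG nm mk).
Qed.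

Lemma eqvM n n' m m' : eqv n n' -> eqv m m' -> eqv (n * m)%g (n' * m')%g.
Proof.
move=> nn mm; rewrite /eqv invgM.
have -> : (n * m * (m'^-1 * n'^-1))%g = ((m * m'^-1) ^ n^-1 * (n * n'^-1))%g.
  by rewrite conjgE invgK !mulgA mulgVK.
by apply: (infM leG) => //; apply: (inf_conj leG zcomm).
Qed.

Lemma eqvV n m : eqv n m -> eqv n^-1%g m^-1%g.
Proof.
move/eqv_sym/(inf_conj leG zcomm m); rewrite conjgE !mulgA mulVg mul1g => H.
by rewrite /eqv invgK.
Qed.

Lemma eqvC n m : eqv (n * m)%g (m * n)%g.
Proof.
have := conj_eqv m (ker_neq0 n^-1%g); rewrite conj_ker_ker /eqv conjgE invgK.
by rewrite invgM !mulgA.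
Qed.

Lemma eqv_pos n m : eqv n m -> pos le z m -> pos le z n.
Proof.
by move=> [nm _] pm; rewrite -[n](mulgVK m); apply: (posM leG).
Qed.

Lemma eqv_prod_const (s : seq L) (f : L -> ker_unit O) n :
  (forall t, eqv (f t) n) -> eqv (\prod_(t <- s) f t)%g (n ^+ size s)%g.
Proof.
move=> fn; elim: s => [|t s IH]; first by rewrite big_nil; apply: eqv_refl.
by rewrite big_cons /= expgS; apply: eqvM.
Qed.

Lemma eqv_prodM (s : seq L) (f h : L -> ker_unit O) :
  eqv (\prod_(t <- s) (f t * h t))%g (\prod_(t <- s) f t * \prod_(t <- s) h t)%g.
Proof.
elim: s => [|t s IH]; first by rewrite !big_nil mulg1; apply: eqv_refl.
rewrite !big_cons; apply: eqv_trans (eqvM (eqv_refl _) IH) _.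
rewrite -!mulgA; apply: eqvM (eqv_refl _) _.
by rewrite !mulgA; apply: eqvM (eqvC _ _) (eqv_refl _).
Qed.

Lemma eqv_prod_perm (s r : seq L) (f : L -> ker_unit O) : perm_eq s r ->
  eqv (\prod_(t <- s) f t)%g (\prod_(t <- r) f t)%g.
Proof.
move=> sr; pose P (r : seq L) := eqv (\prod_(t <- s) f t)%g (\prod_(t <- r) f t)%g.
apply: (@catCA_perm_ind _ P _ _ _ sr); last exact: eqv_refl.
move=> s1 s2 s3 H; apply: eqv_trans H _; rewrite !big_cat /= !mulgA.
by apply: eqvM (eqvC _ _) (eqv_refl _).
Qed.

Definition transfer_term g t : ker_unit O := to_ker O (sec t * g * (sec (t * psi g)%g)^-1).
(** The transfer of D to N; it is a homomorphism modulo infinitesimal elements,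
    because these make N commutative ([eqvC]). *)
Definition transfer g := (\prod_(t <- enum L) transfer_term g t)%g.

Lemma transfer_termE g t : vunit O g ->
  (transfer_term g t)%:D = sec t * g * (sec (t * psi g)%g)^-1.
Proof.
move=> ug; apply: to_kerE; first by apply/vunitM/vunitV/sec_unit/vunitM.
by rewrite !psiM ?divE ?sec0 ?(u0 ug) // psiV // !psi_sec mulgV.
Qed.

Lemma transferM g h : vunit O g -> vunit O h ->
  eqv (transfer (g * h)) (transfer g * transfer h)%g.
Proof.
move=> ug uh; have ugh := vunitM ug uh.
have -> : transfer (g * h) =
    (\prod_(t <- enum L) (transfer_term g t * transfer_term h (t * psi g)))%g.
  apply: eq_bigr => t _; apply: ker_inj.
  rewrite kerME !transfer_termE // psiM ?u0 // mulgA !mulrA.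
  by rewrite div_mulrVK.
apply: eqv_trans (eqv_prodM _ _ _) _; apply: eqvM (eqv_refl _) _.
rewrite -(big_map (fun t => (t * psi g)%g) xpredT (transfer_term h)).
apply: eqv_prod_perm; apply: uniq_perm; rewrite ?enum_uniq //.
  by rewrite map_inj_uniq ?enum_uniq //; apply: mulIg.
move=> t; rewrite mem_enum inE; apply/mapP; exists (t * (psi g)^-1)%g.
  by rewrite mem_enum.
by rewrite mulgVK.
Qed.

Lemma transfer_ker n : eqv (transfer n%:D) (n ^+ #|L|)%g.
Proof.
rewrite cardE; apply: eqv_prod_const => t.
have -> : transfer_term n%:D t = conj_ker (sec t)^-1 n.
  apply: ker_inj; rewrite transfer_termE ?conj_kerE ?divE //; last exact: ker_vunit.
  by rewrite ker_psi mulg1 invrK.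
by apply: conj_eqv; rewrite !divE.
Qed.

Lemma transfer1 : eqv (transfer 1) 1%g.
Proof. by have := transfer_ker 1%g; rewrite expg1n. Qed.

Lemma transferV g : vunit O g -> eqv (transfer g^-1) (transfer g)^-1%g.
Proof.
move=> ug; have := transferM ug (vunitV ug); rewrite div_mulrV ?u0 // => H.
have /(eqvM (eqv_refl (transfer g)^-1%g)) := eqv_trans (eqv_sym H) transfer1.
by rewrite mulKg mulg1.
Qed.

Lemma transferX g k : vunit O g -> eqv (transfer (g ^+ k)) (transfer g ^+ k)%g.
Proof.
move=> ug; elim: k => [|k IH]; first exact: transfer1.
rewrite exprS expgS; apply: eqv_trans (transferM ug (vunitX k ug)) _.
exact: eqvM (eqv_refl _) IH.
Qed.

Definition ker_power g : ker_unit O := to_ker O (g ^+ #|L|).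

Lemma ker_powerE g : vunit O g -> (ker_power g)%:D = g ^+ #|L|.
Proof.
move=> ug; apply: to_kerE; first exact: vunitX.
by rewrite psiX ?u0 // -cardsT expg_cardG ?inE.
Qed.

(** Both sides are the transfer of g ^+ #|L|. *)
Lemma ker_power_eqv g : vunit O g -> eqv (transfer g ^+ #|L|)%g (ker_power g ^+ #|L|)%g.
Proof.
move=> ug; apply: eqv_trans (eqv_sym (transferX _ ug)) _.
by rewrite -ker_powerE //; apply: transfer_ker.
Qed.

Let L_gt0 : (0 < #|L|)%N. Proof. by rewrite -cardsT cardG_gt0. Qed.

Lemma eqv_root_pos n m : eqv (n ^+ #|L|)%g (m ^+ #|L|)%g -> pos le z n -> pos le z m.
Proof.
move=> nm pn; apply: (pos_root leG L_gt0).
by apply: eqv_pos (eqv_sym nm) _; apply: (posX leG).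
Qed.

Lemma transfer_pos g : vunit O g -> pos le z (transfer g) <-> pos le z (ker_power g).
Proof.
move=> ug; have H := ker_power_eqv ug; split; apply: eqv_root_pos => //.
exact: eqv_sym.
Qed.

Lemma transfer_posV g : vunit O g ->
  pos le z (transfer g)^-1%g <-> pos le z (ker_power g)^-1%g.
Proof.
move=> ug; have := eqvV (ker_power_eqv ug); rewrite -!expVgn => H.
by split; apply: eqv_root_pos => //; apply: eqv_sym.
Qed.

(** The new valuation ring: the transfer extends the order of N to all units. *)
Definition finer r := O r /\ (vunit O r -> pos le z (transfer r)).

Lemma finer_O r : finer r -> O r. Proof. by case. Qed.

Lemma finer_max r : vmax O r -> finer r.
Proof. by move=> mr; split; [apply: vmax_O | move=> /vunit_nmax]. Qed.

Lemma finer_unit r : vunit O r -> pos le z (transfer r) -> finer r.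
Proof. by move=> ur pr; split=> //; apply: vunit_O. Qed.

Lemma finer1 : finer 1.
Proof.
apply: finer_unit; first exact: vunit1.
by apply: eqv_pos transfer1 _; apply/(pos_ge1 leG)/(go_refl leG).
Qed.

Lemma finerM r s : finer r -> finer s -> finer (r * s).
Proof.
move=> [Or pr] [Os ps]; split; first exact: vrM.
move=> urs.
have ur : vunit O r by apply: vunitP => // mr; apply: (vunit_nmax urs); apply: vmaxMr.
have us : vunit O s by apply: vunitP => // ms; apply: (vunit_nmax urs); apply: vmaxMl.
by apply: eqv_pos (transferM ur us) _; apply: (posM leG); auto.
Qed.

Lemma finerX r k : finer r -> finer (r ^+ k).
Proof. by move=> fr; elim: k => [|k IH]; [apply: finer1 | rewrite exprS; apply: finerM]. Qed.

Lemma finerN r : finer r -> finer (- r).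
Proof.
move=> fr; rewrite -mulN1r; apply: finerM => //; rewrite -(ker_m1E O).
apply: finer_unit; first exact: ker_vunit.
apply: eqv_pos (transfer_ker _) _; apply: (posX leG).
by apply: (pos_ge1 leG); case: neutral_m1.
Qed.

Lemma finerV r : r != 0 -> finer r \/ finer r^-1.
Proof.
move=> r0; have [mr|mr] := pselect (vmax O r); first by left; apply: finer_max.
have [mr'|mr'] := pselect (vmax O r^-1); first by right; apply: finer_max.
have ur : vunit O r.
  by split=> //; apply: contrapT => nr; [apply: mr' | apply: mr]; right; rewrite ?invrK.
case: (pos_or leG z (transfer r)) => pr; [left | right]; apply: finer_unit => //.
  exact: vunitV.
exact: eqv_pos (transferV ur) _.
Qed.

Lemma vunitJV g r : g != 0 -> vunit O (g^-1 * r * g) -> vunit O r.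
Proof.
move=> g0; have g'0 : g^-1 != 0 by rewrite !divE.
move=> /(vunitJ g'0); rewrite invrK !mulrA div_mulrV // mul1r.
by rewrite div_mulrK.
Qed.

Lemma finerJ g r : g != 0 -> finer r -> finer (g^-1 * r * g).
Proof.
move=> g0 [Or pr]; split; first exact: vrJ.
move=> ugr; have ur := vunitJV g0 ugr.
have /(transfer_pos ur) pk := pr ur; apply/transfer_pos => //.
have -> : ker_power (g^-1 * r * g) = conj_ker g (ker_power r).
  apply: ker_inj; rewrite conj_kerE // !ker_powerE //.
  elim: #|L| => [|k IH]; first by rewrite !expr0 mulr1 div_mulVr.
  by rewrite !exprS IH !mulrA div_mulrK.
exact: eqv_pos (conj_eqv _ g0) pk.
Qed.

(** If r = m * s with s a representative of L and m < z^-2, then z^-1 * r^-1 is small, and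
    so are its powers; this contradicts the hypothesis on the powers of r. *)
Lemma finer_bound r : finer r -> small (z%:D ^+ 3 * r).
Proof.
move=> [Or pr]; have [mr|mr] := pselect (vmax O r).
  by apply/small_max/vmaxMl => //; apply/vrX/vunit_O/ker_vunit.
have ur := vunitP Or mr; have r0 := u0 ur.
pose s := sec (psi r); have us : vunit O s := sec_unit _.
have s0 : s != 0 := u0 us.
pose m := to_ker O (r / s).
have mE : m%:D = r / s.
  apply: to_kerE; first exact/vunitM/vunitV.
  by rewrite psiM ?divE // psiV // /s psi_sec mulgV.
have zm : le (z ^- 2)%g m.
  apply: contrapT => zm.
  have {}zm : le z (z^-1 * m^-1)%g.
    apply: (go_lI leG (c := z)); rewrite mulVKg -expg2 -[X in le X _]invgK.
    by apply: (go_inv leG); case: (go_total leG (z ^- 2)%g m).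
  have [_ _ _] := z_sec (psi r) zm.
  have -> : (sec (psi r))^-1 * (z^-1 * m^-1)%g%:D = z%:D^-1 * r^-1.
    rewrite kerME !kerVE mE div_invM ?divE // invrK mulrA -(centralV divD zC).
    by rewrite -mulrA div_mulKr.
  move=> sx.
  have /(transfer_pos ur)[c cP] := pr ur.
  pose k := (c.+2 * #|L|)%N.
  have k0 : (0 < k)%N by rewrite muln_gt0.
  have := small_exp k.-1 sx; rewrite prednK //.
  have -> : (z%:D^-1 * r^-1) ^+ k = (z ^- k * (ker_power r ^+ c.+2)^-1)%g%:D.
    have zr : GRing.comm z%:D^-1 r^-1 by exact: (centralV divD zC).
    rewrite exprMn_comm // kerME !kerVE !kerXE ker_powerE // -exprM mulnC.
    by rewrite -!exprVn.
  move/small_ge_z => zk.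
  have cz := cP c.+2.
  apply: nz1; apply: (go_lI leG (c := (z ^+ c.+1)%g)).
  rewrite -expgSr mulg1.
  have ck : (c.+2 <= k)%N by rewrite leq_pmulr.
  apply: letr (expz_le ck) _.
  have := go_mul2r leG (ker_power r ^+ c.+2)%g zk; rewrite mulgVK => zk'.
  have := letr (go_mul2l leG z^-1%g cz) zk'.
  by rewrite -invgM -expgSr => /(go_inv leG); rewrite !invgK.
have zm3 : le z (z ^+ 3 * m)%g.
  have := go_mul2l leG (z ^+ 3)%g zm; rewrite [in X in le X]expgS.
  by rewrite mulgK.
have [sm _ _ _] := z_sec (psi r) zm3.
by rewrite kerME kerXE mE -mulrA div_mulrVK in sm.
Qed.

(** Membership in the maximal ideal of the new ring, stated before that ring is known
    to be closed under addition. *)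
Definition infinitely_small r := O r /\ (vunit O r -> ~ pos le z (transfer r)^-1%g).

Lemma infinitely_small_finer r : infinitely_small r -> finer r.
Proof.
move=> [Or nr]; split=> // ur; case: (pos_or leG z (transfer r)) => // pr.
by case: (nr ur).
Qed.

(** By [not_pos_inv_large] a power of r beats any power of z; the remaining factor
    of r ^+ j is controlled by [finer_bound]. *)
Lemma infinitely_small_exp r c : infinitely_small r ->
  exists k, forall j, (k <= j)%N -> small (z%:D ^- c * r ^+ j).
Proof.
move=> ir; have fr := infinitely_small_finer ir; case: ir => Or nr.
have uz j : vunit O (z%:D ^- j) by apply/vunitV/vunitX/ker_vunit.
have [mr|mr] := pselect (vmax O r).
  exists 1%N => -[|j] // _; apply: small_max; apply: vmaxMl; first exact/vunit_O.
  by rewrite exprSr; apply: vmaxMl => //; apply: vrX.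
have ur := vunitP Or mr; have {}nr := nr ur.
have npk : ~ pos le z (ker_power r)^-1%g by move/(transfer_posV ur).
have [k kP] := not_pos_inv_large leG (c + 4)%N npk.
exists (#|L| * k)%N => j kj.
have zk : le z (z ^- (c + 3) * ker_power r ^+ k)%g.
  have := go_mul2l leG (z ^- (c + 3))%g (kP k (leqnn k)).
  by rewrite (_ : (c + 4 = (c + 3) + 1)%N); [rewrite (expgnDr z (c + 3)%N) mulKg | rewrite -addnA].
have -> : z%:D ^- c * r ^+ j = (z ^- (c + 3) * ker_power r ^+ k)%g%:D *
    (z%:D ^+ 3 * r ^+ (j - #|L| * k)).
  rewrite kerME kerVE !kerXE ker_powerE // -exprM -{1}(subnKC kj) exprD.
  have zC3 : central (z%:D ^+ 3) by rewrite -kerXE; apply: kcentralX.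
  have Ez : z%:D ^- (c + 3) * z%:D ^+ 3 = z%:D ^- c.
    by rewrite addnC exprD div_invM ?(div_exp_eq0 divD) ?ker_neq0 // div_mulrVK
       ?(div_exp_eq0 divD) ?ker_neq0.
  rewrite [RHS]mulrA -[in RHS](mulrA _ _ (z%:D ^+ 3)) -zC3.
  by rewrite [in RHS](mulrA _ (z%:D ^+ 3)) Ez [LHS]mulrA.
by apply: smallM; [apply: small_scale | apply/finer_bound/finerX].
Qed.

(** Expand 1 = (r + s) ^+ k for k large, using that r and s commute: each term contains
    a high power of r or of s, so that 1 would be small. *)
Lemma infinitely_small_sum r s : r + s = 1 ->
  infinitely_small r -> infinitely_small s -> False.
Proof.
move=> rs ir is_; apply: small_not1.
have [kr krP] := infinitely_small_exp 3 ir; have [ks ksP] := infinitely_small_exp 3 is_.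
have fr := infinitely_small_finer ir; have fs := infinitely_small_finer is_.
have crs : GRing.comm r s.
  have -> : s = 1 - r by rewrite -rs addrC addKr.
  by rewrite /GRing.comm mulrBl mulrBr mulr1 mul1r.
have zC3 : central (z%:D ^+ 3) by rewrite -kerXE; apply: kcentralX.
have z30 : z%:D ^+ 3 != 0 by rewrite (div_exp_eq0 divD) ?ker_neq0.
have prod a b : small (z%:D ^- 3 * a) -> small (z%:D ^+ 3 * b) -> small (a * b).
  move=> sa sb; have := smallM sa sb.
  by rewrite (centralV divD zC3) -mulrA div_mulKr.
rewrite -(expr1n _ (kr + ks)) -rs addrC exprDn_comm; last exact/commr_sym.
apply: small_sum => i _; apply: small_muln.
have [ksi|ksi] := leqP ks (kr + ks - i).
  by apply: prod; [apply: ksP | apply/finer_bound/finerX].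
have -> : s ^+ (kr + ks - i) * r ^+ i = r ^+ i * s ^+ (kr + ks - i).
  by apply/commrX/commr_sym/commrX.
apply: prod; [apply: krP | exact/finer_bound/finerX].
by rewrite -(leq_add2r ks) -leq_subLR ltnW.
Qed.

(** Dividing by r + s, a failure would give two infinitely small elements with
    sum 1. *)
Lemma finerD r s : finer r -> finer s -> finer (r + s).
Proof.
move=> fr fs; have [Or pr] := fr; have [Os ps] := fs; split; first exact: vrD.
move=> ut; set t := r + s in ut; apply: contrapT => npt; have t0 := u0 ut.
have small_t a : finer a -> infinitely_small (a / t).
  move=> [Oa pa]; split; first by apply: vrM => //; case: ut.
  move=> uat npa; apply: npt.
  have ua : vunit O a by rewrite -(div_mulrVK divD a t0); apply: vunitM.
  have H := transferM uat ut; rewrite div_mulrVK // in H.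
  have /(eqvM (eqv_refl (transfer (a / t))^-1%g)) := eqv_sym H.
  rewrite mulKg => H'; apply: eqv_pos H' _; apply: (posM leG) => //; exact: pa.
apply: (@infinitely_small_sum (r / t) (s / t)); try exact: small_t.
by rewrite -mulrDl div_mulrV.
Qed.

Lemma finerB r s : finer r -> finer s -> finer (r - s).
Proof. by move=> fr fs; apply/finerD/finerN. Qed.

Definition finer_ring : valuation_ring D :=
  ValuationRing divD finer1 finerB finerM finerV finerJ.

Lemma not_finer_scale : ~ finer z^-1%g%:D.
Proof.
move=> [_ /(_ (ker_vunit _))].
move/(eqv_pos (eqv_sym (transfer_ker _)))/(pos_root leG L_gt0) => [c /(_ c.+1)].
rewrite expVgn => /(go_inv leG); rewrite !invgK expgSr => H.
by apply: nz1; apply: (go_lI leG (c := (z ^+ c)%g)); rewrite mulg1.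
Qed.

Lemma transferJ g x : vunit O g -> vunit O x ->
  eqv (transfer (x^-1 * g * x)) (transfer g).
Proof.
move=> ug ux; have uVx := vunitV ux.
apply: eqv_trans (transferM (vunitM uVx ug) ux) _.
apply: eqv_trans (eqvM (transferM uVx ug) (eqv_refl _)) _.
apply: eqv_trans (eqvC _ _) _; rewrite mulgA.
have H := eqvM (eqv_refl (transfer x)) (transferV ux); rewrite mulgV in H.
by have := eqvM H (eqv_refl (transfer g)); rewrite mul1g.
Qed.

Lemma finer_commutator g x : vunit O g -> vunit O x -> finer (g^-1 * (x^-1 * g * x)).
Proof.
move=> ug ux; have ugx : vunit O (x^-1 * g * x) by apply: vunitJ => //; apply: u0.
apply: finer_unit; first exact/vunitM/ugx/vunitV.
apply: eqv_pos (transferM (vunitV ug) ugx) _.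
apply: eqv_pos (eqvM (transferV ug) (transferJ ug ux)) _.
by rewrite mulVg; apply/(pos_ge1 leG)/(go_refl leG).
Qed.

Section CongruenceImage.
Variable g : D.
Hypotheses (mg : vmax finer_ring g) (ug : vunit O g).

Let fg : finer g. Proof. exact: (@vmax_O _ finer_ring). Qed.

Lemma congruence_vunit h : finer h -> vunit finer_ring (1 + g * h).
Proof.
by move=> fh; apply: vunitDm; [apply: vunit1 | apply: (vmaxMr (O := finer_ring))].
Qed.

(** The image in L of the congruence subgroup 1 + g O' of the new ring O'. *)
Definition congruence_image : {set L} :=
  [set t | `[< exists2 h, finer h & psi (1 + g * h) = t >]].

Lemma congruence_imageP t :
  reflect (exists2 h, finer h & psi (1 + g * h) = t) (t \in congruence_image).
Proof. by rewrite inE; apply: asboolP. Qed.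

Fact congruence_image_group_set : group_set congruence_image.
Proof.
apply/group_setP; split.
  by apply/congruence_imageP; exists 0; [apply: (vr0 finer_ring) | rewrite mulr0 addr0 psi1].
move=> _ _ /congruence_imageP[h fh <-] /congruence_imageP[k fk <-].
have [uh uk] := (congruence_vunit fh, congruence_vunit fk).
apply/congruence_imageP; exists (h + k + h * g * k).
  by apply/finerD; [apply: finerD | apply/finerM => //; apply: finerM].
rewrite -psiM ?(vunit_neq0 uh) ?(vunit_neq0 uk) //; congr (psi _).
have -> : g * (h + k + h * g * k) = g * h + g * k + g * h * g * k.
  by rewrite !mulrDr !mulrA.
have -> : (1 + g * h) * (1 + g * k) = 1 + g * k + (g * h + g * h * g * k).
  by rewrite mulrDl mul1r mulrDr mulr1 !mulrA.
by rewrite !addrA (addrAC 1).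
Qed.

Canonical congruence_image_group := Group congruence_image_group_set.

Lemma congruence_image_normal : (congruence_image <| [set: L])%g.
Proof.
apply/normalP; split; first exact: subsetT.
have sub (s : L) : (congruence_image :^ s \subset congruence_image)%g.
  apply/subsetP => _ /imsetP[_ /congruence_imageP[h fh <-] ->].
  have uh := congruence_vunit fh; have us := sec_unit s.
  apply/congruence_imageP; pose x := sec s; have x0 : x != 0 := sec0 s.
  exists (g^-1 * (x^-1 * g * x) * (x^-1 * h * x)).
    by apply: finerM; [apply: finer_commutator | apply: finerJ].
  have -> : 1 + g * (g^-1 * (x^-1 * g * x) * (x^-1 * h * x)) = x^-1 * (1 + g * h) * x.
    rewrite mulrDr mulrDl mulr1 div_mulVr // !mulrA div_mulrV ?u0 // mul1r.
    by rewrite div_mulrK.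
  rewrite !psiM ?divE ?x0 ?(vunit_neq0 uh) // psiV // /x psi_sec.
  by rewrite conjgE mulgA.
move=> s _; apply/eqP; rewrite eqEcard sub cardJg leqnn.
by [].
Qed.

End CongruenceImage.

(** The commutators of 1 + g O' are in 1 + g ^+ 2 O', and L is perfect. *)
Lemma congruence_image_sqr g : vmax finer_ring g -> vunit O g ->
  congruence_image g = [set: L] -> congruence_image (g ^+ 2) = [set: L].
Proof.
move=> mg ug Ag; have fg : finer g := @vmax_O _ finer_ring _ mg.
have g0 := u0 ug.
have mg2 : vmax finer_ring (g ^+ 2) by rewrite expr2; apply: (vmaxMl (O := finer_ring)).
have ug2 : vunit O (g ^+ 2) by apply: vunitX.
have g20 := u0 ug2.
have comm_sub : [~: [set: L], [set: L]]%g \subset congruence_image_group mg2 .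
  rewrite gen_subG; apply/subsetP => _ /imset2P[a b _ _ ->] /=.
  have /congruence_imageP[h fh <-] : a \in congruence_image g by rewrite Ag inE.
  have /congruence_imageP[k fk <-] : b \in congruence_image g by rewrite Ag inE.
  have ua := congruence_vunit mg fh; have ub := congruence_vunit mg fk.
  set x := 1 + g * h in ua *; set y := 1 + g * k in ub *.
  have [x0 y0] := (vunit_neq0 ua, vunit_neq0 ub).
  have [_ _ fVyx] := vunitM ub ua.
  pose c := g^-1 * h * g * k - g^-1 * k * g * h.
  have E : x * y - y * x = g ^+ 2 * c.
    have exp1 p q : (1 + p) * (1 + q) = 1 + p + q + p * q :> D.
      by rewrite mulrDl mul1r mulrDr mulr1 addrA (addrAC 1).
    rewrite /x /y !exp1 (addrAC 1 (g * k)) opprD addrACA subrr add0r.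
    by rewrite /c mulrBr expr2 -!mulrA !div_mulVKr.
  have fc : finer c by apply: finerB; apply: finerM => //; apply: finerJ.
  apply/congruence_imageP; exists (((g ^+ 2)^-1 * (y * x)^-1 * g ^+ 2) * c).
    by apply: finerM => //; apply: finerJ.
  have yx0 : y * x != 0 by rewrite !divE y0.
  have -> : 1 + g ^+ 2 * ((g ^+ 2)^-1 * (y * x)^-1 * g ^+ 2 * c) = (y * x)^-1 * (x * y).
    have conj_mul (p q w : D) : p != 0 -> p * (p^-1 * q * p * w) = q * (p * w).
      by move=> p0; rewrite -!mulrA div_mulVKr.
    by rewrite conj_mul // -E mulrBr (div_mulVr divD yx0) addrC subrK.
  rewrite psiM ?divE ?x0 ?y0 // psiV // !psiM //.
  by rewrite invgM commgEl conjgE !mulgA.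
by apply/eqP; rewrite eqEsubset subsetT -{1}(simple_der1 psi).
Qed.

Lemma congruence_image1 g : vmax finer_ring g -> vunit O g -> congruence_image g = 1%g.
Proof.
move=> mg ug; have [L1 simL] := simpleP _ (dq_simple psi).
case: (simL _ (congruence_image_normal mg ug)) => // Ag; case/eqP: L1.
have ig : infinitely_small g.
  split=> [|_ pg]; first exact: vunit_O.
  case: (mg) => [g0|]; first by move/eqP: (u0 ug).
  apply; apply: finer_unit; first exact: vunitV.
  exact: eqv_pos (transferV ug) pg.
have [k kP] := infinitely_small_exp 3 ig.
(* By perfectness of L, raising g to the powers 2 ^ j keeps the image full. *)
have full j : [/\ vmax finer_ring (g ^+ (2 ^ j)), vunit O (g ^+ (2 ^ j))
    & congruence_image (g ^+ (2 ^ j)) = [set: L]].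
  elim: j => [|j [mgj ugj Agj]]; first by rewrite expr1.
  rewrite expnSr exprM; split; [|exact: vunitX|exact: congruence_image_sqr].
  by rewrite expr2; apply: (vmaxMl (O := finer_ring)) => //; apply: (@vmax_O _ finer_ring).
have [mk uk Ak] := full k; apply: etrans (esym Ak) _; apply/setP => t.
apply/congruence_imageP/set1gP => [[h fh <-]|->]; last first.
  by exists 0; [apply: (vr0 finer_ring) | rewrite mulr0 addr0 psi1].
apply: small_add1; have zC3 : central (z%:D ^+ 3) by rewrite -kerXE; apply: kcentralX.
have z30 : z%:D ^+ 3 != 0 by rewrite (div_exp_eq0 divD) ?ker_neq0.
have kk : (k <= 2 ^ k)%N by rewrite ltnW // ltn_expl.
have := smallM (kP _ kk) (finer_bound fh).
by rewrite (centralV divD zC3) -mulrA div_mulKr.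
Qed.

Lemma finer_compatible r : r != 0 -> ~ finer r^-1 -> psi (1 + r) = 1%g.
Proof.
move=> r0 nr; have [mr|mr] := pselect (vmax O r).
  by case: mr => [r00|]; [rewrite r00 eqxx in r0 | apply: cr_max].
have mr' : vmax finer_ring r by right.
have ur : vunit O r.
  by apply: vunitP => //; apply/finer_O/(@vmax_O _ finer_ring).
apply/set1gP; rewrite -(congruence_image1 mr' ur); apply/congruence_imageP.
by exists 1; [apply: finer1 | rewrite mulr1].
Qed.

Definition finer_compatible_ring : compatible_ring psi :=
  @CompatibleRing D L psi finer_ring finer_compatible.

End Scale.

Lemma exists_finer : exists2 O' : compatible_ring psi, (forall r, O' r -> O r)
  & exists2 r, O r & ~ O' r.
Proof.
have [sec secP] : {sec : L -> D | forall t, vunit O (sec t) /\ psi (sec t) = t}.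
  have /choice[sec secP] : forall t, exists a, vunit O a /\ psi a = t.
    by move=> t; have [a ua pa] := unit_surj t; exists a.
  by exists sec.
have bound t : exists d, forall m, le d m ->
  [/\ small (m%:D * sec t), small (sec t * m%:D)
    , small (m%:D * (sec t)^-1) & small ((sec t)^-1 * m%:D)].
  have [ut _] := secP t.
  have [d dP] := small_bound (vunit_O ut); have [d' dP'] := small_bound (vunit_O (vunitV ut)).
  have [b bP] := go_upper_bound leG [:: d; d'].
  exists b => m bm.
  have [? ?] := dP m (letr (bP d (mem_head _ _)) bm).
  have db : le d' b by apply: bP; rewrite !inE eqxx orbT.
  by have [? ?] := dP' m (letr db bm).
have [bd bdP] := choice bound; have [t t1] := lo_gt1 lo.
have [z zC zP] := central_above ((t * om)%g :: [seq bd v | v : L <- enum L]).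
have z_om : ~ le z om.
  move=> zom; apply: t1; apply: (go_rI leG (c := om)); rewrite mul1g.
  by apply: letr zom; apply: zP; rewrite mem_head.
have z_sec (u : L) m : le z m -> [/\ small (m%:D * sec u), small (sec u * m%:D)
    , small (m%:D * (sec u)^-1) & small ((sec u)^-1 * m%:D)].
  move=> zm; apply: bdP; apply: letr zm; apply: zP; rewrite inE; apply/orP; right.
  by apply: map_f; rewrite mem_enum.
have sec_unit (u : L) : vunit O (sec u) by case: (secP u).
have psi_sec (u : L) : psi (sec u) = u by case: (secP u).
exists (finer_compatible_ring zC z_om sec_unit psi_sec z_sec).
  by move=> r; apply: finer_O.
exists z^-1%g%:D; first exact/vunit_O/ker_vunit.
exact: not_finer_scale.
Qed.

End Small.

(** * Minimal valuation rings *)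

Section AlgebraicValuation.
Variables (D : unitRingType) (O : valuation_ring D).
Hypothesis alg : algebraic_over_center D.
Implicit Types g h x y : D.

Let divD := vr_div O.
Let divE := divE divD.

Lemma power_times_vmax x b j : x != 0 -> vmax O b -> (0 < j)%N ->
  exists2 y, vmax O y & (x * b) ^+ j = x ^+ j * y.
Proof.
move=> x0 mb; case: j => // j _; elim: j => [|j [y my IH]]; first by exists b.
exists (x^-1 * y * x * b); first by apply: vmaxMl => //; apply: vrJ => //; apply: vmax_O.
by rewrite exprSr IH [x ^+ j.+2]exprSr !mulrA div_mulrK.
Qed.

(** Two terms of the equation of g over the center have the same value. *)
Lemma central_power g : g != 0 ->
  exists j c, [/\ (0 < j)%N, c != 0, central c & vunit O (c * g ^+ j)].
Proof.
move=> g0; have [p [p0 pC pg]] := alg g.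
pose nz := [seq i <- iota 0 (size p) | p`_i != 0].
have nzP i : i \in nz -> p`_i != 0 by rewrite mem_filter => /andP[].
pose t i := p`_i * g ^+ i.
have t0 i : i \in nz -> t i != 0 by move=> /nzP pi; rewrite !divE pi (div_exp_eq0 divD).
have sum0 : \sum_(i < size p) t i = 0 by rewrite -[RHS]pg horner_coef.
have tE i : t i = p`_i * g ^+ i by [].
clearbody t.
have [i inz imin] : exists2 i, i \in nz & forall j, j \in nz -> O ((t i)^-1 * t j).
  apply: (@seq_minimum _ (fun i j => O ((t i)^-1 * t j))).
  - move=> i j /t0 ti /t0 tj; have tij : (t i)^-1 * t j != 0 by rewrite !divE ti.
    by case: (vrV O tij) => H; [left | right]; rewrite // div_invM ?divE // invrK in H.
  - move=> j i k /t0 ti /t0 tj /t0 tk ij jk.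
    by have := vrM ij jk; rewrite mulrA div_mulrK.
  - apply/eqP => nz0; have : (size p).-1 \in nz; last by rewrite nz0.
    rewrite mem_filter -/(lead_coef p) lead_coef_eq0 p0 mem_iota add0n /=.
    by rewrite prednK // size_poly_gt0.
have [j [jnz ji uj]] : exists j, [/\ j \in nz, j != i & vunit O ((t i)^-1 * t j)].
  apply: contrapT => nj; apply: (@vmax1 _ O).
  have iN : (i < size p)%N by move: inz; rewrite mem_filter mem_iota => /andP[].
  have -> : 1 = - \sum_(j < size p | j != Ordinal iN) (t i)^-1 * t j.
    apply/eqP; rewrite -addr_eq0 -big_distrr /= -(div_mulVr divD (t0 i inz)) -mulrDr.
    by have := sum0; rewrite (bigD1 (Ordinal iN)) //= => ->; rewrite mulr0.
  apply: vmaxN; elim/big_ind: _ => [|? ? ? ?|j ji]; [exact: vmax0 | exact: vmaxD |].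
  have [pj|pj] := eqVneq p`_j 0; first by rewrite (tE j) pj mul0r mulr0; apply: vmax0.
  have jnz : (j : nat) \in nz by rewrite mem_filter pj mem_iota ltn_ord.
  apply: contrapT => mj; apply: nj; exists (j : nat); split=> //.
  by apply: vunitP => //; apply: imin.
have [pi pj] := (nzP i inz, nzP j jnz).
have quo a b : (a < b)%N -> p`_a != 0 ->
    (t a)^-1 * t b = (p`_a)^-1 * p`_b * g ^+ (b - a).
  move=> ab pa; have cC : central ((p`_a)^-1 * p`_b).
    exact: (centralM (centralV divD (pC a)) (pC b)).
  have ga : g ^+ a != 0 by rewrite (div_exp_eq0 divD).
  have gb : g ^+ b = g ^+ a * g ^+ (b - a) by rewrite -exprD subnKC // ltnW.
  rewrite !tE gb div_invM // mulrA -(mulrA (g ^+ a)^-1).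
  by rewrite -(cC (g ^+ a)^-1) -mulrA div_mulKr.
have cC a b : central ((p`_a)^-1 * p`_b).
  exact: (centralM (centralV divD (pC a)) (pC b)).
case: (ltngtP i j) ji => // ij _.
  exists (j - i)%N, ((p`_i)^-1 * p`_j); rewrite subn_gt0 ij !divE pi pj.
  by rewrite -quo.
exists (i - j)%N, ((p`_j)^-1 * p`_i); rewrite subn_gt0 ij !divE pi pj.
split=> //; rewrite -quo //; have := vunitV uj.
by rewrite div_invM ?divE ?t0 // invrK.
Qed.

(** The value group is abelian: if a = [g, h] were not a unit, (g * a) ^+ j, which is
    conjugate to g ^+ j, would not have the value of g ^+ j; but these values are
    equal when g ^+ j has the value of a central element. *)
Lemma commutator_vunit g h : g != 0 -> h != 0 -> vunit O (g^-1 * (h^-1 * g * h)).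
Proof.
move=> g0 h0; have [j [c [j0 c0 cC ugj]]] := central_power g0.
set a := _ * _; have a0 : a != 0 by rewrite !divE g0 h0.
have gh : h^-1 * g * h = g * a by rewrite div_mulVKr.
clearbody a; set g' := g * a in gh; have g'0 : g' != 0 by rewrite !divE g0.
have E : h^-1 * (c * g ^+ j) * h = c * g' ^+ j.
  rewrite mulrA -cC -!mulrA; congr (_ * _); rewrite mulrA -gh.
  elim: j {j0 ugj} => [|j IH]; first by rewrite !expr0 mulr1 div_mulVr.
  by rewrite !exprS -IH !mulrA div_mulrK.
have ug'j : vunit O (c * g' ^+ j) by rewrite -E; apply: vunitJ.
have gj0 : g ^+ j != 0 by rewrite (div_exp_eq0 divD).
have g'j0 : g' ^+ j != 0 by rewrite (div_exp_eq0 divD).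
have uquo : vunit O ((g ^+ j)^-1 * g' ^+ j).
  have := vunitM (vunitV ugj) ug'j.
  by rewrite div_invM // -mulrA div_mulKr.
have nm b x y : x != 0 -> x * b = y -> vunit O ((x ^+ j)^-1 * y ^+ j) -> ~ vmax O b.
  move=> x0 <- u mb; have [w mw E'] := power_times_vmax x0 mb j0.
  apply: (vunit_nmax u); rewrite E' div_mulKr //.
  by rewrite (div_exp_eq0 divD).
have na : ~ vmax O a by apply: (nm a g g').
have naV : ~ vmax O a^-1.
  apply: (nm a^-1 g' g) => //; first by rewrite /g' div_mulrK.
  by have := vunitV uquo; rewrite div_invM ?divE // invrK.
by split=> //; apply: contrapT => nO; [apply: naV | apply: na]; right; rewrite ?invrK.
Qed.

End AlgebraicValuation.

Section Minimal.
Variables (D : unitRingType) (L : finGroupType) (psi : division_quotient D L).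
Hypothesis alg : algebraic_over_center D.

(** All commutators of D are units of O, and L is perfect. *)
Lemma unit_image_full (O : compatible_ring psi) t : exists2 a, vunit O a & psi a = t.
Proof.
have u0 x : vunit O x -> x != 0 by case.
pose A := [set t | `[< exists2 a, vunit O a & psi a = t >]].
have AP s : reflect (exists2 a, vunit O a & psi a = s) (s \in A).
  by rewrite inE; apply: asboolP.
have gA : group_set A.
  apply/group_setP; split; first by apply/AP; exists 1; [apply: vunit1 | apply: psi1].
  move=> _ _ /AP[a ua <-] /AP[b ub <-]; apply/AP; exists (a * b); first exact: vunitM.
  by rewrite dq_mul ?u0.
suff : t \in A by move/AP.
suff : [~: [set: L], [set: L]]%g \subset Group gA.
  by rewrite (simple_der1 psi) => /subsetP; apply; rewrite inE.
rewrite gen_subG; apply/subsetP => _ /imset2P[a b _ _ ->]; apply/AP.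
have [x x0 <-] := dq_surj psi a; have [y y0 <-] := dq_surj psi b.
exists (x^-1 * (y^-1 * x * y)); first exact: commutator_vunit.
have divE := divE (dq_div psi).
by rewrite !dq_mul ?divE ?x0 ?y0 // !psiV // commgEl conjgE !mulgA.
Qed.

(** The intersection of a chain of compatible rings is one of them. *)
Lemma exists_minimal_ring : exists O : compatible_ring psi,
  forall O' : compatible_ring psi, (forall x, O' x -> O x) -> forall x, O x -> O' x.
Proof.
pose R (s t : compatible_ring psi) : bool := `[< forall x, t x -> s x >].
have divD := dq_div psi.
pose whole : compatible_ring psi := @CompatibleRing D L psi
  (@ValuationRing D (fun=> True) divD I (fun _ _ _ _ => I) (fun _ _ _ _ => I)
    (fun _ _ => or_introl I) (fun _ _ _ _ => I))
  (fun r _ nr => False_ind _ (nr I)).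
have [| | |O minO] := @classical_sets.ZL_preorder _ whole R.
- by move=> t; apply/asboolP.
- by move=> r s t /asboolP rs /asboolP st; apply/asboolP => x /st /rs.
- move=> A totA; pose I r := forall O : compatible_ring psi, A O -> O r.
  have I1 : I 1 by move=> O _; apply: vr1.
  have IB x y : I x -> I y -> I (x - y) by move=> Ix Iy O AO; apply: vrB; auto.
  have IM x y : I x -> I y -> I (x * y) by move=> Ix Iy O AO; apply: vrM; auto.
  have nI r : ~ I r -> exists2 O : compatible_ring psi, A O & ~ O r.
    move=> nr; apply: contrapT => nO; apply: nr => O AO.
    by apply: contrapT => nOr; apply: nO; exists O.
  have IV x : x != 0 -> I x \/ I x^-1.
    move=> x0; apply: contrapT => /not_orP[/nI[O1 A1 n1] /nI[O2 A2 n2]].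
    case: (totA O1 O2 A1 A2) => /asboolP sub.
      by case: (vrV O2 x0) => // /sub.
    by case: (vrV O1 x0) => // /sub.
  have IJ x r : x != 0 -> I r -> I (x^-1 * r * x) by move=> x0 Ir O AO; apply: vrJ; auto.
  have Imax r : r != 0 -> ~ I r^-1 -> psi (1 + r) = 1%g.
    by move=> r0 /nI[O AO]; apply: cr_max.
  exists (@CompatibleRing D L psi (@ValuationRing D I divD I1 IB IM IV IJ) Imax).
  by move=> O AO; apply/asboolP => x; apply.
- exists O => O' sub; have H : R O O' by apply/asboolP.
  by have /asboolP := minO O' H.
Qed.

Lemma no_division_quotient :
  (4%:E < commuting_diam L)%E \/ balanced L -> False.
Proof.
move=> /graph_pair[x [y [/eqP x1 /eqP y1 xy]]].
have [O minO] := exists_minimal_ring.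
have [le lo] := exists_leveled_order x1 y1 xy (unit_image_full O).
have [om om1 om_level] := lo_level lo.
have [O' sub [r Or nr]] := exists_finer (unit_image_full O) alg lo om1 om_level.
exact/nr/(minO O' sub).
Qed.

End Minimal.

(** * Finite dimensional division algebras *)

Lemma falgebra_algebraic (F : fieldType) (D : falgType F) : algebraic_over_center D.
Proof.
move=> x; pose n := \dim {:D}; pose X := [tuple x ^+ i | i < n.+1].
have nfree : ~~ free X.
  apply/negP; rewrite /free size_tuple => /eqP dX.
  by have := dimvS (subvf <<X>>%VS); rewrite dX ltnn.
have [k [kX [i ki]]] : exists k : 'I_n.+1 -> F,
    \sum_(i < n.+1) k i *: X`_i = 0 /\ exists i, k i != 0.
  apply: contrapT => nk; case/negP: nfree; apply/freeP => k kX i.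
  by apply/eqP; apply: contrapT => /negP ki; apply: nk; exists k; split=> //; exists i.
exists (\poly_(i < n.+1) (k (inord i))%:A); split.
- apply: contraNneq ki => /polyP/(_ i); rewrite coef_poly ltn_ord inord_val coef0.
  by move/eqP; rewrite scaler_eq0 oner_eq0 orbF.
- move=> j; rewrite coef_poly; case: ifP => _ y; last by rewrite mul0r mulr0.
  by rewrite -scalerAl mul1r -scalerAr mulr1.
- rewrite horner_poly -[RHS]kX; apply: eq_bigr => j _.
  by rewrite inord_val -scalerAl mul1r -tnth_nth tnth_mktuple.
Qed.

Lemma iso_division_quotient (L : finGroupType) (D : unitRingType)
    (N : normal_subgroup (units D)) :
  simple [set: L]%g -> ~~ abelian [set: L]%g -> division_ring D ->
  group_isomorphic (group_quotient N) L -> inhabited (division_quotient D L).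
Proof.
move=> L_simple L_nonabelian divD [f [fM [f' fK f'K]]].
pose u (x : D) : units D := insubd (units_one D) x.
have uE x : x != 0 -> val (u x) = x by move=> x0; rewrite val_insubd divD.
pose psi (x : D) := f (\pi_(group_quotient N)%qT (u x)).
have psiM x y : x != 0 -> y != 0 -> psi (x * y) = (psi x * psi y)%g.
  move=> x0 y0; have xy0 : x * y != 0 by rewrite (div_mul_eq0 divD) negb_or x0.
  rewrite /psi -fM [(_ * _)%g]qmul_pi; congr (f (\pi_(group_quotient N)%qT _)).
  by apply: val_inj; rewrite uE //= !uE.
have psi_surj t : exists2 x, x != 0 & psi x = t.
  have [a fa] : exists a, f (\pi_(group_quotient N)%qT a) = t.
    by rewrite -(f'K t); elim/quotW: (f' t) => a; exists a.
  exists (val a); first by apply: contraTneq (valP a) => ->; rewrite unitr0.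
  by rewrite /psi /u valKd.
by split; apply: (DivisionQuotient divD psiM psi_surj).
Qed.

Local Close Scope ring_scope.

Theorem theoremA (L : finGroupType)
    (L_simple : simple [set: L]%g) (L_nonabelian : ~~ abelian [set: L]%g)
    (L_graph : (4%:E < commuting_diam L)%E \/ balanced L)
    (F : fieldType) (D : falgType F)
    (D_division : forall x : D, x != 0%R -> x \is a GRing.unit) :
  ~ exists N : normal_subgroup (units D),
      group_isomorphic (group_quotient N) L.
Proof.
move=> [N isoN].
have [psi] := iso_division_quotient L_simple L_nonabelian D_division isoN.
exact: (no_division_quotient psi (@falgebra_algebraic F D) L_graph).
Qed.
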